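(* Let $d\ge1$ and let $\sigma\colon\mathbb{R}\to\mathbb{R}$ be Lipschitz continuous such that there are constants $k_1,k_2>0$ with $k_1<\sigma(x)<k_2$ for all $x\in\mathbb{R}$. Let $Y$ be the mild solution to the stochastic heat equation with multiplicative Lévy noise $\sigma(Y)\dot\Lambda$ with Lévy measure $\lambda$ (see context), and let $Y_0(t)=Y(t,0)$. Let $\varepsilon>0$ be such that $\int_{\mathbb{R}}|z|^{1+\varepsilon}\,\lambda(dz)<\infty$, and assume $\int_{-1}^1|z\log|z||\,\lambda(dz)<\infty$. Then for every $p\in(0,1+\varepsilon]\cap(0,1+2/d)$, $$\limsup_{t\to\infty}\mathbb{E}\left[\left|\frac{Y_0(t)}{t}\right|^p\right]<\infty.$$
   Context: The heat kernel on $\mathbb{R}^d$ is $g(t,x)=(4\pi t)^{-d/2}e^{-|x|^2/(4t)}$ for $t>0$, and $g(t,x)=0$ for $t\le 0$. Let $\lambda$ be a Lévy measure on $\mathbb{R}$ (so $\lambda(\{0\})=0$), not identically zero, with $\int_{\mathbb{R}}|z|\,\lambda(dz)<\infty$. Let $\mu$ be a Poisson random measure on $(0,\infty)\times\mathbb{R}^d\times\mathbb{R}$ with intensity $dt\,dx\,\lambda(dz)$ and points $(\tau_i,\eta_i,\zeta_i)_{i\in\mathbb{N}}$. Let $m\in\mathbb{R}$ (the mean) and $m_0=m-\int_{\mathbb{R}}z\,\lambda(dz)$ (the drift). The Lévy space-time white noise without Gaussian part is $\Lambda(dt,dx)=m_0\,dt\,dx+\int_{\mathbb{R}}z\,\mu(dt,dx,dz)$.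 The equation is $\partial_tY=\Delta Y+\sigma(Y)\dot\Lambda$ on $(0,\infty)\times\mathbb{R}^d$, $Y(0,\cdot)=0$. Its mild solution (known to exist and to be unique under these assumptions) is the predictable process $Y$ satisfying $Y(t,x)=\int_0^t\int_{\mathbb{R}^d}g(t-s,x-y)\,\sigma(Y(s,y))\,\Lambda(ds,dy)$, i.e. $Y(t,x)=m_0\int_0^t\int_{\mathbb{R}^d}g(t-s,x-y)\sigma(Y(s,y))\,dy\,ds+\sum_{\tau_i\le t}g(t-\tau_i,x-\eta_i)\sigma(Y(\tau_i,\eta_i))\zeta_i$. *)

(* Defs.v *)
From HB Require Import structures.
From mathcomp Require Import all_boot all_order all_algebra.
From mathcomp Require Import all_classical all_reals all_analysis.
From mathcomp Require Import measurable_realfun.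

Set Implicit Arguments.
Unset Strict Implicit.
Unset Printing Implicit Defensive.

Import Order.TTheory GRing.Theory Num.Theory.
Import numFieldNormedType.Exports.

Local Open Scope classical_set_scope.
Local Open Scope ring_scope.

(* R^d as d-tuples, which the library equips with the product sigma-algebra
   (it has no measurable structure on row vectors). *)
Notation Rd R d := (d.-tuple (measurableTypeR R)).

Notation jump_space R d :=
  (measurableTypeR R * Rd R d * measurableTypeR R)%type.

Section euclidean_space.
Context {R : realType}.

Definition Rd_zero (d : nat) : Rd R d := [tuple (0 : R) | i < d].

Definition Rd_sub (d : nat) (x y : Rd R d) : Rd R d :=
  [tuple ((tnth x i : R) - (tnth y i : R)) | i < d].

Definition Rd_sqnorm (d : nat) (x : Rd R d) : R :=
  \sum_(i < d) (tnth x i : R) ^+ 2.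

Definition Rd_cons (d : nat) (xy : measurableTypeR R * Rd R d) : Rd R d.+1 :=
  [tuple of xy.1 :: xy.2].

Lemma measurable_Rd_cons (d : nat) : measurable_fun setT (@Rd_cons d).
Proof. exact: measurable_cons. Qed.

Section lebesgue_step.
Context (d : nat) (m : {sigma_finite_measure set (Rd R d) -> \bar R}).

Definition lebesgue_step : set (Rd R d.+1) -> \bar R :=
  pushforward (@lebesgue_measure R \x m)%E (@Rd_cons d).

Let lebesgue_stepP :
  exists mu : {measure set (Rd R d.+1) -> \bar R}, lebesgue_step = mu.
Proof.
pose pm : {measure set (measurableTypeR R * Rd R d) -> \bar R} :=
  (@lebesgue_measure R \x m)%E.
pose mu : {measure set (Rd R d.+1) -> \bar R} := pushforward pm (@Rd_cons d).
by exists (mu (@measurable_Rd_cons d)).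
Qed.

Let lebesgue_step0 : lebesgue_step set0 = 0%E.
Proof. by have [mu ->] := lebesgue_stepP; exact: measure0. Qed.

Let lebesgue_step_ge0 A : (0 <= lebesgue_step A)%E.
Proof. by have [mu ->] := lebesgue_stepP; exact: measure_ge0. Qed.

Let lebesgue_step_sigma_additive : semi_sigma_additive lebesgue_step.
Proof.
by have [mu ->] := lebesgue_stepP; exact: measure_semi_sigma_additive.
Qed.

HB.instance Definition _ := isMeasure.Build _ _ _ lebesgue_step
  lebesgue_step0 lebesgue_step_ge0 lebesgue_step_sigma_additive.

Let lebesgue_step_sigma_finite : sigma_finite setT lebesgue_step.
Proof.
pose split1 (t : Rd R d.+1) : measurableTypeR R * Rd R d :=
  (thead t, [tuple of behead t]).
have msplit : measurable_fun setT split1.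
  apply/measurable_fun_pairP; split => /=; first exact: measurable_tnth.
  exact: measurable_behead.
have splitK : cancel (@Rd_cons d) split1.
  by case=> x y; rewrite /split1 /=; congr pair; exact/val_inj.
have /sigma_finiteP[F [FT ndF Foo]] := sigma_finiteT (@lebesgue_measure R).
have /sigma_finiteP[G [GT ndG Goo]] := sigma_finiteT m.
exists (fun k => split1 @^-1` (F k `*` G k)).
  rewrite -preimage_bigcup -[LHS](preimage_setT split1); congr (_ @^-1` _).
  apply/esym/seteqP; split => // -[x y] _.
  have [i _ Fx] : (\bigcup_i F i) x by rewrite -FT.
  have [j _ Gy] : (\bigcup_i G i) y by rewrite -GT.
  exists (maxn i j) => //; split => /=.
    by move: Fx; exact/subsetPset/ndF/leq_maxl.
  by move: Gy; exact/subsetPset/ndG/leq_maxr.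
move=> k; have [mF Fk] := Foo k; have [mG Gk] := Goo k; split.
  by rewrite -[X in measurable X]setTI; apply: msplit => //; exact: measurableX.
rewrite /lebesgue_step /pushforward -comp_preimage.
rewrite (_ : split1 \o _ = id); last by apply/funext => x; exact: splitK.
by rewrite preimage_id product_measure1E// lte_mul_pinfty// ge0_fin_numE.
Qed.

HB.instance Definition _ :=
  Measure_isSigmaFinite.Build _ _ _ lebesgue_step lebesgue_step_sigma_finite.

End lebesgue_step.

(* Lebesgue measure on R^d as the d-fold product of lebesgue_measure. *)
Fixpoint lebesgue_Rd (d : nat) : {sigma_finite_measure set (Rd R d) -> \bar R} :=
  match d with
  | 0 => \d_([tuple] : Rd R 0)
  | d'.+1 => lebesgue_step (lebesgue_Rd d')
  end.

Definition heat_kernel (d : nat) (t : R) (x : Rd R d) : R :=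
  if 0 < t
  then (4 * pi * t) `^ (- (d%:R / 2)) * expR (- (Rd_sqnorm x / (4 * t)))
  else 0.

End euclidean_space.

Section poisson_random_measure.
Context {R : realType} {dO : measure_display} {Omega : measurableType dO}.
Context (P : probability Omega R).
Context {dE : measure_display} {E : measurableType dE}.

Definition point_measure (X : nat -> Omega -> E) (w : Omega) : set E -> \bar R :=
  mseries (fun i => \d_(X i w)) 0.

(* The second argument of poisson_prob is a dummy that does not affect its
   value. *)
Record poisson_random_measure (nu : set E -> \bar R)
    (N : Omega -> set E -> \bar R) : Prop := PoissonRandomMeasure {
  prm_measurable : forall A, measurable A -> measurable_fun setT (N ^~ A) ;
  prm_poisson : forall A, measurable A -> (nu A < +oo)%E ->
    forall k : nat, P [set w | N w A = k%:R%:E] =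
                    poisson_prob (fine (nu A)) k [set k] ;
  prm_infinite : forall A, measurable A -> nu A = +oo%E ->
    P [set w | N w A = +oo%E] = 1%E ;
  prm_independent : forall (n : nat) (A : 'I_n -> set E),
    (forall i, measurable (A i)) -> trivIset setT A ->
    forall B : 'I_n -> set \bar R, (forall i, measurable (B i)) ->
    P (\bigcap_i [set w | B i (N w (A i))]) =
      (\prod_(i < n) P [set w | B i (N w (A i))])%E
}.

End poisson_random_measure.

Section filtrations.
Context {R : realType} {dO : measure_display} {Omega : measurableType dO}.
Implicit Types F : R -> set (set Omega).

Record filtration F : Prop := Filtration {
  filtration_sigma_algebra : forall t : R, 0 <= t -> sigma_algebra setT (F t) ;
  filtration_measurable : forall t : R, 0 <= t -> F t `<=` measurable ;
  filtration_monotone : forall s t : R, 0 <= s -> s <= t -> F s `<=` F t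
}.

(* The predictable sigma-algebra on (0, oo) x Omega x R^d. *)
Definition predictable_sigma_algebra (d : nat) F :
    set (set (R * Omega * Rd R d)) :=
  <<s [set z | 0 < z.1.1],
      [set C | exists (s t : R) (G : set Omega) (B : set (Rd R d)),
        [/\ 0 <= s, s <= t, F s G, measurable B &
            C = [set z | [/\ s < z.1.1, z.1.1 <= t, G z.1.2 & B z.2]]]] >>.

Definition predictable (d : nat) F (Y : R -> Rd R d -> Omega -> R) : Prop :=
  forall B : set R, measurable B ->
    predictable_sigma_algebra F [set z | 0 < z.1.1 /\ B (Y z.1.1 z.2 z.1.2)].

End filtrations.

Section levy_noise.
Context {R : realType} {dO : measure_display} {Omega : measurableType dO}.
Context (P : probability Omega R) (d : nat).
Implicit Types lambda : {measure set (measurableTypeR R) -> \bar R}.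

Definition levy_measure lambda : Prop :=
  lambda [set (0 : R)] = 0%E /\
  (\int[lambda]_z (Num.min 1 ((z : R) ^+ 2))%:E < +oo)%E.

(* dt dx lambda(dz) on (0, oo) x R^d x R, viewed as a measure on
   R x R^d x R. *)
Definition levy_intensity lambda :
    set (jump_space R d) -> \bar R :=
  fun A => ((@lebesgue_measure R \x lebesgue_Rd d) \x lambda)%E
             (A `&` [set u | 0 < (u.1.1 : R)]).

Definition marked_points (tau : nat -> Omega -> R) (eta : nat -> Omega -> Rd R d)
    (zeta : nat -> Omega -> R) (i : nat) (w : Omega) : jump_space R d :=
  (tau i w, eta i w, zeta i w).

(* (tau_i, eta_i, zeta_i) are the points of a Poisson random measure with
   intensity dt dx lambda(dz), relative to the filtration F: its restriction to
   (0, t] is F_t-measurable and its restriction to (t, oo) is independent of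
   F_t. *)
Record levy_poisson_points (F : R -> set (set Omega)) lambda
    (tau : nat -> Omega -> R) (eta : nat -> Omega -> Rd R d)
    (zeta : nat -> Omega -> R) : Prop := LevyPoissonPoints {
  lpp_tau_gt0 : forall i w, 0 < tau i w ;
  lpp_measurable : forall i, measurable_fun setT (marked_points tau eta zeta i) ;
  lpp_poisson : poisson_random_measure P (levy_intensity lambda)
    (point_measure (marked_points tau eta zeta)) ;
  lpp_adapted : forall t : R, 0 <= t ->
    forall A : set (jump_space R d), measurable A ->
    A `<=` [set u | (u.1.1 : R) <= t] ->
    forall B : set \bar R, measurable B ->
    F t [set w | B (point_measure (marked_points tau eta zeta) w A)] ;
  lpp_independent : forall t : R, 0 <= t -> forall G H : set Omega, F t G ->
    <<s [set C | exists (A : set (jump_space R d)) (B : set \bar R),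
      [/\ measurable A, A `<=` [set u | t < (u.1.1 : R)], measurable B &
          C = [set w | B (point_measure (marked_points tau eta zeta) w A)]]]
    >> H ->
    P (G `&` H) = (P G * P H)%E
}.

(* Mild solution of the heat equation driven by the noise with drift m0 and
   points (tau_i, eta_i, zeta_i).  At t = 0 the right-hand side vanishes, which
   is the initial condition. *)
Record mild_solution (F : R -> set (set Omega)) (m0 : R)
    (tau : nat -> Omega -> R) (eta : nat -> Omega -> Rd R d)
    (zeta : nat -> Omega -> R) (sigma : R -> R)
    (Y : R -> Rd R d -> Omega -> R) : Prop := MildSolution {
  mild_predictable : predictable F Y ;
  mild_equation : forall (t : R) (x : Rd R d), 0 <= t ->
    {ae P, forall w, Y t x w =
      m0 * (\int[lebesgue_measure]_(s in `[0, t]) \int[lebesgue_Rd d]_y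
              (heat_kernel (t - s) (Rd_sub x y) * sigma (Y s y w)))
      + limn (series (fun i =>
          if tau i w <= t
          then heat_kernel (t - tau i w) (Rd_sub x (eta i w)) *
               sigma (Y (tau i w) (eta i w) w) * zeta i w
          else 0))}
}.

End levy_noise.

(* Main.v *)
Require Import Defs.
From HB Require Import structures.
From mathcomp Require Import all_boot all_order all_algebra.
From mathcomp Require Import all_classical all_reals all_analysis.
From mathcomp Require Import measurable_realfun ring lra.

Set Implicit Arguments.
Unset Strict Implicit.
Unset Printing Implicit Defensive.

Import Order.TTheory GRing.Theory Num.Theory.
Import numFieldNormedType.Exports.

Local Open Scope classical_set_scope.
Local Open Scope ring_scope.

(** Since sigma takes values in (k1, k2), the solution satisfies
    |Y(t,0)| <= k2 |m0| t + k2 S with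
    S = sum_i g(t - tau_i, eta_i) |zeta_i|, so it suffices to bound
    E[(S/t)^p] uniformly in t >= 1.  For independent Poisson variables N_i of
    mean nu_i and T = sum_i a_i N_i, the identity
    E[N_i h(N)] = nu_i E[h(N + e_i)] gives
    E[T^q] = sum_i a_i nu_i E[(T + a_i)^(q-1)], and hence, by induction on the
    integer part of q, a bound on E[T^q] in terms of sum_i a_i nu_i and
    sum_i a_i^q nu_i only.  Monotone approximation by simple functions extends
    it to Poisson integrals.  For S/t the two quantities are controlled by the
    Gaussian estimate  int g(u,y)^r dy <= u^(-d(r-1)/2)  with r = 1 and
    r = max(1,p); the singularity at u = 0 is integrable exactly when
    r < 1 + 2/d. *)
(** * Fractional moments of sums of Poisson variables *)

(** The coefficients sigma(Y) at the jump points depend on the very points being summed. Bounding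
    them by [k2] path by path leaves S, a linear functional of the points with nonnegative terms, so
    every estimate can be made in the extended reals with no integrability established beforehand.
    The recursion bounds a moment of order q by one of order q - 1, so there is no circularity, and
    it stops at orders in (0, 1], where x^q <= 1 + x. Intermediate orders produce sums of a_i^q
    nu_i; since a^q <= a + a^p for q between 1 and p, the exponents 1 and p suffice. Division by t
    is the right scale: the kernel has mass 1 at each positive time, so the mean of S is at most t
    times the integral of |z|, and S/t has bounded mean. In the sum for the exponent r the powers of
    t combine to t^(-r) t^(1 - d(r-1)/2), which is at most 1 for t >= 1. *)

Lemma esumZl_le (R : realType) (T : choiceType) (c : R) (a : T -> \bar R) :
  0 <= c -> (forall i, (0 <= a i)%E) ->
  (\esum_(i in setT) (c%:E * a i) <= c%:E * \esum_(i in setT) a i)%E.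
Proof.
move=> c0 a0; apply: ge_ereal_sup => _ [X [finX XT] <-].
rewrite -ge0_mule_fsumr//; apply: lee_wpmul2l; first by rewrite lee_fin.
by apply: esum_ge; exists X.
Qed.

Section poisson_weights.
Context {R : realType} (n : nat).
Implicit Types (w h : {ffun 'I_n -> nat} -> R) (a nu : 'I_n -> R).
Implicit Types m : {ffun 'I_n -> nat}.

Definition incr_at (k : 'I_n) m : {ffun 'I_n -> nat} :=
  [ffun i => (m i + (i == k))%N].

(** An unordered sum in the extended reals, so moments make sense before they are known to be
    finite. *)
Definition wmean w h : \bar R := \esum_(m in setT) (h m * w m)%:E.

Definition lincomb a m : R := \sum_(i < n) a i * (m i)%:R.

Lemma lincomb_incr_at a k m : lincomb a (incr_at k m) = lincomb a m + a k.
Proof.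
rewrite /lincomb [in RHS](bigD1 k)//= (bigD1 k)//= ffunE eqxx addn1 -natr1.
rewrite mulrDr mulr1 -!addrA; congr (_ + _); rewrite [RHS]addrC; congr (_ + _).
by apply: eq_bigr => i /negbTE ik; rewrite ffunE ik addn0.
Qed.

Lemma lincomb_ge0 a m : (forall i, 0 <= a i) -> 0 <= lincomb a m.
Proof. by move=> a0; apply: sumr_ge0 => i _; rewrite mulr_ge0. Qed.

Lemma wmean_ge0 w h : (forall m, 0 <= w m) -> (forall m, 0 <= h m) ->
  (0 <= wmean w h)%E.
Proof. by move=> w0 h0; apply: esum_ge0 => m _; rewrite lee_fin mulr_ge0. Qed.

Lemma le_wmean w h1 h2 : (forall m, 0 <= w m) -> (forall m, h1 m <= h2 m) ->
  (wmean w h1 <= wmean w h2)%E.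
Proof. by move=> w0 h12; apply: le_esum => m _; rewrite lee_fin ler_wpM2r. Qed.

Lemma wmeanD w h1 h2 : (forall m, 0 <= w m) ->
  (forall m, 0 <= h1 m) -> (forall m, 0 <= h2 m) ->
  wmean w (fun m => h1 m + h2 m) = (wmean w h1 + wmean w h2)%E.
Proof.
move=> w0 h10 h20; rewrite /wmean -esumD; [|by move=> m _; rewrite lee_fin mulr_ge0..].
by apply: eq_esum => m _; rewrite mulrDl EFinD.
Qed.

Lemma wmeanZ_le w h c : (forall m, 0 <= w m) -> (forall m, 0 <= h m) ->
  0 <= c -> (wmean w (fun m => c * h m)%R <= c%:E * wmean w h)%E.
Proof.
move=> w0 h0 c0; rewrite /wmean.
under eq_esum do rewrite -mulrA EFinM.
by apply: esumZl_le => // m; rewrite lee_fin mulr_ge0.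
Qed.

Lemma wmean_sum w (h : 'I_n -> {ffun 'I_n -> nat} -> R) :
  (forall m, 0 <= w m) -> (forall i m, 0 <= h i m) ->
  wmean w (fun m => \sum_(i < n) h i m) = (\sum_(i < n) wmean w (h i))%E.
Proof.
move=> w0 h0; rewrite /wmean -esum_sum; last first.
  by move=> m i _ _; rewrite lee_fin mulr_ge0.
by apply: eq_esum => m _; rewrite mulr_suml sumEFin.
Qed.

(* The size-biasing recursion that characterizes products of Poisson laws. *)
Definition poisson_weights nu w : Prop :=
  [/\ (forall m, 0 <= w m), (wmean w (fun=> 1%R) <= 1)%E &
      forall k m, (m k).+1%:R * w (incr_at k m) = nu k * w m].

(** Terms with [m k = 0] vanish, and [incr_at k] maps all multi-indices bijectively onto the
    remaining ones; the recursion for [w] then trades the factor [m k] for [nu k]. This is one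
    direction of the Chen-Stein (Mecke) identity. *)
Lemma stein_poisson nu w h k : poisson_weights nu w -> 0 <= nu k ->
  (forall m, 0 <= h m) ->
  (wmean w (fun m => (m k)%:R * h m)%R <=
   (nu k)%:E * wmean w (fun m => h (incr_at k m)))%E.
Proof.
move=> [w0 _ wS] nu0 h0; rewrite /wmean.
have -> : \esum_(m in [set: {ffun 'I_n -> nat}]) ((m k)%:R * h m * w m)%:E =
          \esum_(m in [set m : {ffun 'I_n -> nat} | (0 < m k)%N]) ((m k)%:R * h m * w m)%:E.
  rewrite [RHS]esum_mkcond; apply: eq_esum => m _.
  case: ifPn => // /negP mk0; have [->|mk_gt0] := posnP (m k).
    by rewrite !mul0r.
  by exfalso; apply: mk0; rewrite inE.
rewrite (@reindex_esum _ _ _ setT _ (incr_at k)); last first.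
  split.
  - by move=> m _ /=; rewrite ffunE eqxx addn1.
  - by move=> m1 m2 _ _ /ffunP e; apply/ffunP => i; move: (e i); rewrite !ffunE => /addIn.
  - move=> m /= mk; exists [ffun i => (m i - (i == k))%N] => //.
    apply/ffunP => i; rewrite !ffunE subnK//.
    by have [->|] := eqVneq i k.
apply: le_trans; last apply: esumZl_le => //; last first.
  by move=> m; rewrite lee_fin mulr_ge0.
apply: le_esum => m _; rewrite -EFinM lee_fin.
rewrite ffunE eqxx addn1 mulrAC wS -!mulrA ler_wpM2l//.
by rewrite mulrC.
Qed.

End poisson_weights.

(** The sum is at most twice the larger term, which treats concave and convex powers alike. *)
Lemma powRD_le (R : realType) (x y r : R) : 0 <= r -> 0 <= x -> 0 <= y ->
  (x + y) `^ r <= 2 `^ r * (x `^ r + y `^ r).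
Proof.
move=> r0 x0 y0; wlog xy : x y x0 y0 / x <= y => [H|].
  by case: (leP x y) => [|/ltW] xy; [|rewrite addrC [_ `^ r + _]addrC]; exact: H.
apply: (@le_trans _ _ ((2 * y) `^ r)).
  by apply: ge0_ler_powR => //; rewrite ?nnegrE ?addr_ge0 ?mulr_ge0// mulr_natl mulr2n lerD.
by rewrite powRM// ler_wpM2l ?powR_ge0// lerDr powR_ge0.
Qed.

(** Compare with the exponent [r] when [x >= 1] and with [p] when [x < 1]. This controls
    intermediate powers both of the weights [a i] and of the jump sizes. *)
Lemma powR_le_interp (R : realType) (x p q r : R) : 0 <= x -> 0 < p ->
  p <= q -> q <= r -> x `^ q <= x `^ p + x `^ r.
Proof.
move=> x0 p0 pq qr; have [x1|x1] := leP 1 x.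
  by rewrite (le_trans (ler_powR x1 qr))// lerDr powR_ge0.
move: x0; rewrite le_eqVlt => /predU1P[<-|x0].
  by rewrite !powR0 ?addr0// gt_eqF// ?(lt_le_trans p0)// (le_trans pq).
have x01 : 0 < x <= 1 by rewrite x0 ltW.
by rewrite (le_trans (ger_powR x01 pq))// lerDl powR_ge0.
Qed.

Section poisson_moments.
Context {R : realType} (n : nat).
Variables (w : {ffun 'I_n -> nat} -> R) (a nu : 'I_n -> R).
Hypotheses (a0 : forall i, 0 <= a i) (nu0 : forall i, 0 <= nu i).
Hypothesis pw : poisson_weights nu w.

Lemma wmean_lincomb_powRS (r M L : R) : 0 <= r ->
  \sum_(i < n) a i * nu i <= M -> \sum_(i < n) a i `^ (r + 1) * nu i <= L ->
  (wmean w (fun m => (lincomb a m `^ (r + 1))%R) <=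
   (2 `^ r)%:E * (M%:E * wmean w (fun m => (lincomb a m `^ r)%R) + L%:E))%E.
Proof.
move=> r0 aM aL; have [w0 w1 _] := pw.
have S0 m : 0 <= lincomb a m by exact: lincomb_ge0.
have r1 : 0 < r + 1 by rewrite ltr_wpDl.
have -> : (fun m => lincomb a m `^ (r + 1)) =
    (fun m => \sum_(i < n) a i * ((m i)%:R * lincomb a m `^ r)).
  apply/funext => m; rewrite -mulr_powRB1// addrK {1}/lincomb mulr_suml.
  by apply: eq_bigr => i _; rewrite mulrA.
rewrite wmean_sum//; last by move=> i m; rewrite !mulr_ge0// powR_ge0.
set E := wmean w (fun m => (lincomb a m `^ r)%R).
have E0 : (0 <= E)%E by apply: wmean_ge0 => // m; exact: powR_ge0.
have step i : (wmean w (fun m => (a i * ((m i)%:R * lincomb a m `^ r))%R) <=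
    (a i * nu i)%:E * ((2 `^ r)%:E * (E + (a i `^ r)%:E)))%E.
  apply: le_trans.
    apply: wmeanZ_le => // m. by apply: mulr_ge0 => //; exact: powR_ge0.
  rewrite EFinM -muleA; apply: lee_wpmul2l; first by rewrite lee_fin.
  apply: le_trans.
    by apply: stein_poisson pw _ _ => // m; exact: powR_ge0.
  apply: lee_wpmul2l; first by rewrite lee_fin.
  apply: (@le_trans _ _ (wmean w (fun m => (2 `^ r * (lincomb a m `^ r + a i `^ r))%R))).
    by apply: le_wmean => // m; rewrite lincomb_incr_at; exact: powRD_le.
  apply: le_trans.
    by apply: wmeanZ_le => // m; rewrite addr_ge0// powR_ge0.
  apply: lee_wpmul2l; first by rewrite lee_fin powR_ge0.
  rewrite wmeanD//; [|by move=> m; exact: powR_ge0..].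
  apply: leeD2l.
  have -> : (fun=> a i `^ r) = (fun _ : {ffun 'I_n -> nat} => a i `^ r * 1).
    by apply/funext => m; rewrite mulr1.
  apply: le_trans; first by apply: wmeanZ_le => //; exact: powR_ge0.
  by rewrite -[leRHS]mule1; apply: lee_wpmul2l => //; rewrite lee_fin powR_ge0.
apply: le_trans; first by apply: lee_sum => i _; exact: step.
have -> : (\sum_(i < n) (a i * nu i)%:E * ((2 `^ r)%:E * (E + (a i `^ r)%:E)) =
   (2 `^ r)%:E * ((\sum_(i < n) a i * nu i)%R%:E * E +
      (\sum_(i < n) a i `^ (r + 1) * nu i)%R%:E))%E.
  rewrite -!sumEFin ge0_sume_distrl; last by move=> i _; rewrite lee_fin mulr_ge0.
  rewrite -big_split/= ge0_sume_distrr; last first.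
    by move=> i _; apply: adde_ge0; rewrite ?mule_ge0// lee_fin mulr_ge0// powR_ge0.
  apply: eq_bigr => i _; rewrite muleCA; congr (_ * _)%E.
  rewrite ge0_muleDr// ?lee_fin ?powR_ge0//; congr (_ + _)%E.
  by rewrite -EFinM -(mulr_powRB1 (a0 i) r1) addrK mulrAC.
apply: lee_wpmul2l; first by rewrite lee_fin powR_ge0.
by apply: leeD; [apply: lee_wpmul2r|]; rewrite ?lee_fin.
Qed.

(** [1 + 2 * M] bounds all moments of order at most 1 and stays as a summand so that every later
    constant still does. In the recursive term, 2^p dominates 2^(q-1), and the last [2 * M]
    dominates the sum of a_i^q nu_i. *)
Fixpoint moment_const (p M : R) (k : nat) : R :=
  if k is k'.+1 then
    1 + 2 * M + 2 `^ p * (M * moment_const p M k' + 2 * M)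
  else 1 + 2 * M.

Lemma moment_const_ge p M k : 0 <= M -> 1 + 2 * M <= moment_const p M k.
Proof.
move=> M0; elim: k => //= k IH; rewrite lerDl mulr_ge0 ?powR_ge0//.
by rewrite addr_ge0 ?mulr_ge0//; apply: le_trans IH; rewrite addr_ge0 ?mulr_ge0.
Qed.

(** At most [k] subtractions of 1 bring an order [q <= k + 1] into (0, 1]. *)
Lemma wmean_lincomb_powR (p M : R) k q :
  \sum_(i < n) a i * nu i <= M -> \sum_(i < n) a i `^ p * nu i <= M ->
  0 < q -> q <= k.+1%:R -> (q <= 1) || (q <= p) ->
  (wmean w (fun m => (lincomb a m `^ q)%R) <= (moment_const p M k)%:E)%E.
Proof.
move=> aM apM; have [w0 w1 _] := pw.
have M0 : 0 <= M by apply: le_trans aM; apply: sumr_ge0 => i _; rewrite mulr_ge0.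
have S0 m : 0 <= lincomb a m by exact: lincomb_ge0.
(* The recursion at r = 0: T^0 = 1 has total mass at most 1, so the mean of T is at most M + M. *)
have E1 : (wmean w (fun m => (lincomb a m `^ 1)%R) <= (2 * M)%:E)%E.
  have := @wmean_lincomb_powRS 0 M M (lexx 0) aM; rewrite add0r.
  have -> : \sum_(i < n) a i `^ 1 * nu i = \sum_(i < n) a i * nu i.
    by apply: eq_bigr => i _; rewrite powRr1.
  move=> /(_ aM) /le_trans; apply; rewrite powRr0 mul1e mulr2n mulrDl mul1r EFinD.
  apply: leeD2r; rewrite -[leRHS]mule1; apply: lee_wpmul2l => //.
  by under [X in wmean _ X]funext do rewrite powRr0.
have small q' : 0 < q' -> q' <= 1 ->
    (wmean w (fun m => (lincomb a m `^ q')%R) <= (1 + 2 * M)%:E)%E.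
  move=> q0 q1; apply: (@le_trans _ _ (wmean w (fun m => (1 + lincomb a m `^ 1)%R))).
    apply: le_wmean => // m; rewrite powRr1//.
    have [x1|x1] := leP 1 (lincomb a m).
      by rewrite (le_trans (ler1_powR x1 q1))// lerDr.
    apply: (@le_trans _ _ 1); last by rewrite lerDl.
    rewrite -[leRHS](powRr0 (lincomb a m)).
    have := S0 m; rewrite le_eqVlt => /predU1P[<-|x0].
      by rewrite powR0 ?gt_eqF// powR_ge0.
    by apply: ger_powR; rewrite ?x0 ?ltW.
  rewrite wmeanD//; last by move=> m; exact: powR_ge0.
  by rewrite EFinD leeD.
elim: k q => [|k IH] q q0 qk qp; first exact: small.
have [q1|q1] := leP q 1.
  by apply: le_trans (small _ q0 q1) _; rewrite lee_fin moment_const_ge.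
have {}qp : q <= p by move: qp; rewrite leNgt q1.
have r0 : 0 < q - 1 by rewrite subr_gt0.
have aqM : \sum_(i < n) a i `^ (q - 1 + 1) * nu i <= 2 * M.
  rewrite subrK mulr2n mulrDl mul1r; apply: le_trans (lerD aM apM).
  rewrite -big_split/=; apply: ler_sum => i _; rewrite -mulrDl ler_wpM2r//.
  by have := powR_le_interp (a0 i) ltr01 (ltW q1) qp; rewrite powRr1.
have := wmean_lincomb_powRS (ltW r0) aM aqM; rewrite subrK => /le_trans; apply.
have IHr : (wmean w (fun m => (lincomb a m `^ (q - 1))%R) <= (moment_const p M k)%:E)%E.
  apply: IH => //; first by rewrite lerBlDr natr1.
  by rewrite orbC (le_trans _ qp)// lerBlDr lerDl.
apply: (@le_trans _ _ ((2 `^ p)%:E * (M%:E * (moment_const p M k)%:E + (2 * M)%:E))%E).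
  apply: lee_pmul; rewrite ?lee_fin ?powR_ge0//.
  - rewrite adde_ge0 ?lee_fin ?mulr_ge0// mule_ge0 ?lee_fin//.
    by apply: wmean_ge0 => // m; exact: powR_ge0.
  - by apply: ler_powR; rewrite ?ler1n// (le_trans _ qp)// lerBlDr lerDl.
  - by apply: leeD2r; apply: lee_wpmul2l.
by rewrite [leLHS](_ : _ = (2 `^ p * (M * moment_const p M k + 2 * M))%:E)// lee_fin /=
  lerDr addr_ge0// mulr_ge0.
Qed.

End poisson_moments.

(** * Poisson random measures *)

Lemma ge0_integral_bigcup_count d (T : measurableType d) (R : realType)
    (mu : {measure set T -> \bar R}) (I : countType) (C : I -> set T)
    (f : T -> \bar R) :
  (forall i, measurable (C i)) -> trivIset setT C ->
  measurable_fun (\bigcup_i C i) f -> (forall x, 0 <= f x)%E ->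
  (\int[mu]_(x in \bigcup_i C i) f x = \esum_(i in setT) \int[mu]_(x in C i) f x)%E.
Proof.
move=> mC tC mf f0.
(* Enumerates the family over [nat]; codes that name no index receive the empty set, which changes
   neither the union nor disjointness. *)
pose D j := if pickle_inv j is Some i then C i else set0 : set T.
have CD : \bigcup_i C i = \bigcup_j D j.
  apply/seteqP; split => x [i _].
    by exists (pickle i) => //; rewrite /D pickleK_inv.
  by rewrite /D; case: pickle_inv => // j; exists j.
rewrite CD ge0_integral_bigcup//=; last 3 first.
- by move=> j; rewrite /D; case: pickle_inv.
- by rewrite -CD.
- apply/trivIsetP => i j _ _ ij; rewrite /D.
  case Ei : (pickle_inv i) => [k|]; last by rewrite set0I.
  case Ej : (pickle_inv j) => [l|]; last by rewrite setI0.
  move/trivIsetP : tC; apply => //; apply: contra ij => /eqP kl.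
  have := @pickle_invK I i; have := @pickle_invK I j; rewrite Ei Ej /= => <- <-.
  by rewrite kl.
rewrite nneseries_esumT; last by move=> j; apply: integral_ge0.
rewrite -[RHS](_ : \esum_(j in [set (pickle : I -> nat) i | i in setT])
    \int[mu]_(x in D j) f x = _)%E; last first.
  rewrite esum_image; first by apply: eq_esum => i _; rewrite /D pickleK_inv.
  by move=> i j _ _ /(congr1 (@pickle_inv I)); rewrite !pickleK_inv => -[].
rewrite [RHS]esum_mkcond; apply: eq_esum => j _; case: ifPn => // /negP jI.
rewrite /D; case Ej : (pickle_inv j) => [l|]; last by rewrite integral_set0.
exfalso; apply: jI; rewrite inE; exists l => //.
by have := @pickle_invK I j; rewrite Ej.
Qed.

Lemma poisson_probS (R : realType) (r : R) k : 0 <= r ->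
  (poisson_prob r k.+1 [set k.+1] * k.+1%:R%:E =
   r%:E * poisson_prob r k [set k])%E.
Proof.
rewrite /poisson_prob le_eqVlt => /predU1P[<-|r0].
  (* At rate 0 the law is by convention the Dirac mass at 0, so both sides vanish. *)
  by rewrite ltxx /= !diracE memNset ?mul0e.
rewrite r0 !esum_set1 ?lee_fin ?poisson_pmf_ge0// /poisson_pmf r0 -!EFinM.
congr EFin; rewrite exprS factS natrM.
by field; rewrite ?nat1r ?natr1 !pnatr_eq0 -lt0n fact_gt0.
Qed.

Section counts.
Context {R : realType} {dO : measure_display} {Omega : measurableType dO}.
Context (P : probability Omega R).
Context {dE : measure_display} {E : measurableType dE}.
Variables (nu : {measure set E -> \bar R}).
Variables (N : Omega -> set E -> \bar R).
Hypothesis NP : poisson_random_measure P nu N.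

(** The events [N w A = k] are disjoint and their probabilities are the Poisson weights, which sum
    to 1. *)
Lemma prm_count_ae (A : set E) : measurable A -> (nu A < +oo)%E ->
  {ae P, forall w, exists k : nat, N w A = k%:R%:E}.
Proof.
move=> mA Aoo; pose B := \bigcup_k [set w | N w A = k%:R%:E].
have mk k : measurable [set w | N w A = k%:R%:E].
  rewrite -[X in measurable X]setTI.
  exact: (prm_measurable NP mA measurableT (emeasurable_set1 _)).
have mB : measurable B by exact: bigcup_measurable.
exists (~` B); split; [exact: measurableC| |]; last first.
  by move=> w /= nk [k _ wk]; apply: nk; exists k.
rewrite probability_setC//.
rewrite [X in (1 - X)%E](_ : _ = 1%E) ?subee//.
rewrite measure_bigcup//; last first.
  apply/trivIsetP => i j _ _ ij; apply/seteqP; split => // w [/= -> [/eqP]].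
  by rewrite eqr_nat (negbTE ij).
rewrite -(probability_setT (poisson_prob (fine (nu A)) 0)).
rewrite [in RHS](_ : [set: nat] = \bigcup_k [set k]); last first.
  by apply/seteqP; split => // k _; exists k.
rewrite [RHS]measure_bigcup//; last first.
  by apply/trivIsetP => i j _ _ /eqP ij; apply/seteqP; split => // k [/= -> /ij].
by apply: eq_eseriesr => k _; exact: (prm_poisson NP mA Aoo k).
Qed.

Section disjoint_family.
Variables (n : nat) (A : 'I_n -> set E).
Hypotheses (mA : forall i, measurable (A i)) (tA : trivIset setT A).
Hypothesis Aoo : forall i, (nu (A i) < +oo)%E.

(** Up to a null set these events partition the sample space by the vector of counts, which turns
    expectations into sums over [m]. *)
Let level (m : {ffun 'I_n -> nat}) : set Omega :=
  \bigcap_i [set w | [set (m i)%:R%:E] (N w (A i))].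

Let weight (m : {ffun 'I_n -> nat}) : R := fine (P (level m)).

Let measurable_level m : measurable (level m).
Proof.
apply: fin_bigcap_measurable => [|i _]; first exact: finite_finset.
rewrite -[X in measurable X]setTI.
exact: (prm_measurable NP (mA i) measurableT (emeasurable_set1 _)).
Qed.

Let trivIset_level : trivIset setT level.
Proof.
apply/trivIsetP => m1 m2 _ _ /eqP m12; apply/seteqP; split => // w [w1 w2].
apply: m12; apply/ffunP => i; have := w1 i I; have := w2 i I => /= -> [/eqP].
by rewrite eqr_nat => /eqP.
Qed.

Let level_ae : P (~` \bigcup_m level m) = 0%E.
Proof.
apply/measure_negligible.
  by apply: measurableC; apply: countable_bigcupT_measurable.
have : {ae P, forall w i, exists k : nat, N w (A i) = k%:R%:E}.
  by apply: filter_forall => i; exact: prm_count_ae.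
apply: negligibleS => w /= nw H; apply: nw.
have [f Hf] := choice H; exists [ffun i => f i] => // i _ /=.
by rewrite ffunE.
Qed.

Let wE m : (weight m)%:E = P (level m).
Proof. by rewrite /weight fineK// fin_num_measure. Qed.

Let levelE m :
  P (level m) = (\prod_(i < n) poisson_prob (fine (nu (A i))) (m i) [set m i])%E.
Proof.
rewrite /level (prm_independent NP mA tA (fun i => emeasurable_set1 _)).
by apply: eq_bigr => i _; rewrite -(prm_poisson NP).
Qed.

(** Independence factors the probability of a level into Poisson probabilities. Raising [m k] by 1
    changes only the factor of index [k], and there the recursion is the one for consecutive Poisson
    weights. *)
Lemma poisson_weights_level :
  poisson_weights (fun i => fine (nu (A i))) weight.
Proof.
split => [m||k m].
- by rewrite fine_ge0.
- rewrite /wmean; under eq_esum do rewrite mul1r wE -[P _]mul1e -integral_cst//.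
  rewrite -ge0_integral_bigcup_count//.
  rewrite integral_cst; last exact: countable_bigcupT_measurable.
  by rewrite mul1e probability_le1//; exact: countable_bigcupT_measurable.
- apply: EFin_inj; rewrite !EFinM !wE !levelE.
  rewrite (bigD1 k)//= [in RHS](bigD1 k)//= !muleA ffunE eqxx addn1; congr (_ * _)%E.
    by rewrite muleC poisson_probS// fine_ge0.
  by apply: eq_bigr => i /negbTE ik; rewrite ffunE ik addn0.
Qed.

Lemma integral_lincomb_powR (a : 'I_n -> R) (q : R) : (forall i, 0 <= a i) ->
  (\int[P]_w ((\sum_(i < n) (a i)%:E * N w (A i)) `^ q) =
   wmean weight (fun m => (lincomb a m `^ q)%R))%E.
Proof.
move=> a0; have mU : measurable (\bigcup_m level m).
  exact: countable_bigcupT_measurable.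
have mf : measurable_fun setT (fun w => (\sum_(i < n) (a i)%:E * N w (A i)) `^ q)%E.
  apply: (measurableT_comp (measurable_poweR q)).
  apply: emeasurable_sum => i; apply: emeasurable_funM => //.
  exact: (prm_measurable NP).
rewrite (ge0_negligible_integral (measurableC mU) _ _ _ level_ae)//; last first.
  by move=> w _; exact: poweR_ge0.
rewrite setTD setCK ge0_integral_bigcup_count//; last 2 first.
- exact: measurable_funTS.
- by move=> w; exact: poweR_ge0.
apply: eq_esum => m _; rewrite EFinM wE -integral_cst//.
apply: eq_integral => w /set_mem wm /=; rewrite -poweR_EFin -sumEFin; congr (_ `^ _)%E.
by apply: eq_bigr => i _; rewrite EFinM (wm i I).
Qed.

End disjoint_family.
End counts.

(** * Moments of Poisson integrals of nonnegative functions *)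

Import HBNNSimple HBSimple.

(** One decomposition has to serve the intensity and every realization of the random measure, and
    both [phi] and its p-th power; hence the quantification over [mu] and [psi] inside the
    existential. The zero level is left out because its measure may be infinite; [psi 0 = 0] makes
    this harmless. *)
Lemma nnsfun_levels d (E : measurableType d) (R : realType)
    (phi : {nnsfun E >-> R}) :
  exists n (a : 'I_n -> R) (A : 'I_n -> set E),
    [/\ forall i, 0 < a i, forall i, measurable (A i), trivIset setT A &
    forall (mu : {measure set E -> \bar R}) (psi : R -> R), psi 0 = 0 ->
      (forall x, 0 <= x -> 0 <= psi x) ->
      (\int[mu]_x (psi (phi x))%:E = \sum_(i < n) (psi (a i))%:E * mu (A i))%E].
Proof.
pose s := finmap.enum_fset (fset_set (range phi `&` [set r | 0 < r])).
have fr : finite_set (range phi `&` [set r | 0 < r]).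
  by apply: finite_setIl; exact: fimfunP.
have sE r : (r \in s) = (r \in range phi `&` [set r | 0 < r]).
  by rewrite -(in_fset_set fr).
pose a (i : 'I_(size s)) := tnth (in_tuple s) i.
have aS i : (range phi `&` [set r | 0 < r]) (a i).
  by apply: set_mem; rewrite -sE mem_tnth.
have us : uniq s by exact: finmap.fset_uniq.
have a_inj : injective a by move/tuple_uniqP : (us : uniq (in_tuple s)).
have mA i : measurable (phi @^-1` [set a i]).
  exact: measurable_sfunP.
exists (size s), a, (fun i => phi @^-1` [set a i]); split => //.
- by move=> i; case: (aS i).
- apply/trivIsetP => i j _ _ /eqP ij; apply/seteqP; split => // x [/= -> /a_inj].
  by move/ij.
move=> mu psi psi0 psige.
under eq_integral => x _.
  rewrite (_ : (psi (phi x))%:E =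
      (\sum_(i < size s) (psi (a i))%:E * (\1_(phi @^-1` [set a i]) x)%:E)%E); last first.
    have [x0|x0] := eqVneq (phi x) 0.
      rewrite x0 psi0 big1// => i _; rewrite indicE memNset ?mule0//= x0.
      by move=> e; have [_ /=] := aS i; rewrite -e ltxx.
    have xs : phi x \in s.
      by rewrite sE inE; split; [exists x|rewrite /= lt_neqAle eq_sym x0 fun_ge0].
    have /tnthP[i xi] : phi x \in in_tuple s by [].
    rewrite (bigD1 i)//= big1 => [|j ji]; last first.
      rewrite indicE memNset ?mule0//= xi => /a_inj ij.
      by rewrite ij eqxx in ji.
    by rewrite adde0 indicE mem_set ?mule1 ?xi.
  over.
rewrite ge0_integral_sum//; last 2 first.
- move=> i; apply: emeasurable_funM => //.
  by apply: measurableT_comp => //; exact: measurable_indic.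
- by move=> i x _; rewrite mule_ge0// lee_fin ?psige// ltW; case: (aS i).
apply: eq_bigr => i _; rewrite ge0_integralZl//.
- by rewrite integral_indic// setIT.
- by apply: measurableT_comp => //; exact: measurable_indic.
- by rewrite lee_fin psige// ltW; case: (aS i).
Qed.

Lemma ereal_nondecreasing_le_lim (R : realType) (u : (\bar R)^nat) n :
  nondecreasing_seq u -> (u n <= limn u)%E.
Proof.
move=> nd; rewrite (cvg_lim _ (ereal_nondecreasing_cvgn nd))//.
by apply: ereal_sup_ubound; exists n.
Qed.

Section poisson_integral.
Context {R : realType} {dO : measure_display} {Omega : measurableType dO}.
Context (P : probability Omega R).
Context {dE : measure_display} {E : measurableType dE}.
Variables (nu : {measure set E -> \bar R}).
Variables (N : Omega -> {measure set E -> \bar R}).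
Hypothesis NP : poisson_random_measure P nu (fun w => N w).

Lemma measurable_nnsfun_poisson_integral (phi : {nnsfun E >-> R}) :
  measurable_fun setT (fun w => \int[N w]_x (phi x)%:E)%E.
Proof.
have [n [a [A [a0 mA tA H]]]] := nnsfun_levels phi.
under eq_fun do rewrite (H _ id)//.
apply: emeasurable_sum => i; apply: emeasurable_funM => //.
exact: (prm_measurable NP).
Qed.

Lemma nnsfun_poisson_integral_moment (phi : {nnsfun E >-> R}) (p q M : R) k :
  0 < p -> 0 < q -> q <= k.+1%:R -> (q <= 1) || (q <= p) ->
  (\int[nu]_x (phi x)%:E <= M%:E)%E ->
  (\int[nu]_x (phi x `^ p)%:E <= M%:E)%E ->
  (\int[P]_w ((\int[N w]_x (phi x)%:E) `^ q) <= (moment_const p M k)%:E)%E.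
Proof.
move=> p0 q0 qk qp; have [n [a [A [a0 mA tA H]]]] := nnsfun_levels phi.
rewrite (H nu id)// (H nu (fun x => x `^ p)); last 2 first.
- by rewrite powR0// gt_eqF.
- by move=> x _; exact: powR_ge0.
move=> phiM phipM.
(* Since [a i > 0], a level of infinite intensity would make the integral of [phi] infinite.
   Finiteness is what makes the counts Poisson variables. *)
have Aoo i : (nu (A i) < +oo)%E.
  have : ((a i)%:E * nu (A i) < +oo)%E.
    apply: le_lt_trans (ltry M); apply: le_trans phiM.
    rewrite (bigD1 i)//= leeDl//; apply: sume_ge0 => j _.
    by rewrite mule_ge0// lee_fin ltW.
  by apply: contraTT; rewrite -leNgt leye_eq => /eqP ->; rewrite gt0_muley ?lte_fin// ltxx.
have nuE i : (fine (nu (A i)))%:E = nu (A i) by rewrite fineK// ge0_fin_numE.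
have sumM (c : 'I_n -> R) : (\sum_(i < n) (c i)%:E * nu (A i) <= M%:E)%E ->
    \sum_(i < n) c i * fine (nu (A i)) <= M.
  rewrite -lee_fin; apply: le_trans; rewrite -sumEFin.
  by apply: lee_sum => i _; rewrite EFinM nuE.
under eq_integral do rewrite (H _ id)//.
rewrite (integral_lincomb_powR NP)//; last by move=> i; exact: ltW.
apply: (wmean_lincomb_powR _ _ (poisson_weights_level NP mA tA Aoo)) => //; try exact: sumM.
by move=> i; exact: ltW.
Qed.

Section approximation.
Variables (f : E -> R).
Hypotheses (mf : measurable_fun setT f) (f0 : forall x, 0 <= f x).

Let mEf : measurable_fun setT (EFin \o f).
Proof. exact: measurableT_comp. Qed.

Let phi := nnsfun_approx measurableT mEf.

Let phi_nd x : {homo (fun n => phi n x) : m n / (m <= n)%N >-> m <= n}.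
Proof. by move=> m n mn; exact/lefP/nd_nnsfun_approx. Qed.

Let phi_cvg x : (phi n x)%:E @[n --> \oo] --> (f x)%:E.
Proof. by apply: cvg_nnsfun_approx => // y _; rewrite lee_fin. Qed.

Let mphi n : measurable_fun setT (fun x => (phi n x)%:E).
Proof. by apply: measurableT_comp => //; exact: measurable_funPTI. Qed.

Let phi_le n x : phi n x <= f x.
Proof.
rewrite -lee_fin -(cvg_lim _ (@phi_cvg x))//.
apply: (@ereal_nondecreasing_le_lim _ (fun n => (phi n x)%:E)).
by move=> m k mk; rewrite lee_fin; exact: phi_nd.
Qed.

Let cvg_int (mu : {measure set E -> \bar R}) :
  (\int[mu]_x (phi n x)%:E @[n --> \oo] --> \int[mu]_x (f x)%:E)%E.
Proof.
rewrite (eq_integral (fun x => limn (fun n => (phi n x)%:E))); last first.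
  by move=> x _; apply/esym/cvg_lim.
apply: cvg_monotone_convergence => //.
- by move=> n x _; rewrite lee_fin.
- by move=> x _ m n mn; rewrite lee_fin; exact: phi_nd.
Qed.

Lemma measurable_poisson_integral :
  measurable_fun setT (fun w => \int[N w]_x (f x)%:E)%E.
Proof.
apply: emeasurable_fun_cvg => [n|w _]; last exact: cvg_int.
exact: measurable_nnsfun_poisson_integral.
Qed.

Lemma poisson_integral_moment (p q M : R) k :
  0 < p -> 0 < q -> q <= k.+1%:R -> (q <= 1) || (q <= p) ->
  (\int[nu]_x (f x)%:E <= M%:E)%E ->
  (\int[nu]_x (f x `^ p)%:E <= M%:E)%E ->
  (\int[P]_w ((\int[N w]_x (f x)%:E) `^ q) <= (moment_const p M k)%:E)%E.
Proof.
move=> p0 q0 qk qp fM fpM.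
pose T n w := (\int[N w]_x (phi n x)%:E)%E.
have T0 n w : (0 <= T n w)%E by apply: integral_ge0 => x _; rewrite lee_fin.
have ndT w : {homo (fun n => T n w) : m n / (m <= n)%N >-> (m <= n)%E}.
  move=> m n mn; apply: ge0_le_integral => //.
  - by move=> x _; rewrite lee_fin.
  - by move=> x _; rewrite lee_fin; exact: phi_nd.
have ndTq w : {homo (fun n => T n w `^ q)%E : m n / (m <= n)%N >-> (m <= n)%E}.
  move=> m n mn; apply: gt0_ler_poweR; rewrite ?in_itv/= ?leey ?andbT ?T0//.
  - exact: ltW.
  - exact: ndT.
have cvgTq w : cvgn (fun n => T n w `^ q)%E by exact: ereal_nondecreasing_is_cvgn.
have mTq n : measurable_fun setT (fun w => T n w `^ q)%E.
  apply: (measurableT_comp (measurable_poweR q)).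
  exact: measurable_nnsfun_poisson_integral.
apply: (@le_trans _ _ (\int[P]_w limn (fun n => T n w `^ q))%E).
  apply: ge0_le_integral => //.
  - by move=> w _; exact: poweR_ge0.
  - apply: (measurableT_comp (measurable_poweR q)).
    exact: measurable_poisson_integral.
  - by apply: (emeasurable_fun_cvg (fun n w => T n w `^ q)%E).
  (* In place of continuity of the power, take the q-th root of [L]: each [T n w] is at most
     L^(1/q), hence so is their limit. *)
  move=> w _; set L := limn _.
  have L0 : (0 <= L)%E by apply: lime_ge => //; apply: nearW => n; exact: poweR_ge0.
  have -> : L = ((L `^ q^-1) `^ q)%E by rewrite -poweRrM mulVf ?gt_eqF// poweRe1.
  apply: gt0_ler_poweR; rewrite ?in_itv/= ?leey ?andbT ?poweR_ge0//; first exact: ltW.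
    by apply: integral_ge0 => x _; rewrite lee_fin.
  rewrite -(cvg_lim _ (@cvg_int (N w)))//; apply: lime_le.
    by apply/cvg_ex; eexists; exact: cvg_int.
  apply: nearW => n; rewrite -[leLHS]poweRe1; last exact: T0.
  rewrite -[X in (_ `^ X)%E](mulfV (lt0r_neq0 q0)) poweRrM.
  apply: gt0_ler_poweR; rewrite ?in_itv/= ?leey ?andbT ?poweR_ge0//.
    by rewrite invr_ge0 ltW.
  exact: (@ereal_nondecreasing_le_lim _ (fun n => T n w `^ q)%E).
rewrite monotone_convergence//; last by move=> n w _; exact: poweR_ge0.
apply: lime_le.
  apply: ereal_nondecreasing_is_cvgn => m n mn; apply: ge0_le_integral => //.
  - by move=> w _; exact: poweR_ge0.
  - by move=> w _; exact: ndTq.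
apply: nearW => n; apply: (nnsfun_poisson_integral_moment p0 q0 qk qp).
- apply: le_trans fM; apply: ge0_le_integral => //.
  + by move=> x _; rewrite lee_fin.
  + by move=> x _; rewrite lee_fin; exact: phi_le.
- apply: le_trans fpM; apply: ge0_le_integral => //.
  + by move=> x _; rewrite lee_fin powR_ge0.
  + apply/measurable_EFinP; apply: (measurableT_comp (measurable_powR p)).
    exact/measurable_EFinP/mphi.
  + apply/measurable_EFinP; exact: (measurableT_comp (measurable_powR p)).
  + move=> x _; rewrite lee_fin.
    apply: (ge0_ler_powR (ltW p0) _ _ (phi_le n x)); rewrite nnegrE ?f0 ?fun_ge0//.
Qed.

End approximation.
End poisson_integral.

(** * Integrals of the heat kernel *)

Section heat_kernel_integrals.
Context {R : realType}.

Lemma integral_gauss (c : R) : 0 < c ->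
  (\int[lebesgue_measure]_x (expR (- ((x : R) ^+ 2 / c)))%:E =
   (Num.sqrt (pi * c))%:E)%E.
Proof.
(* The centred normal law of variance [c / 2] has density proportional to the integrand. *)
move=> c0; pose s : R := Num.sqrt (c / 2).
have s2 : s ^+ 2 *+ 2 = c.
  by rewrite sqr_sqrtr ?divr_ge0 1?ltW// -[_ *+ 2]mulr_natr divfK.
have s0 : s != 0 by rewrite gt_eqF// sqrtr_gt0 divr_gt0.
have sp : 0 < Num.sqrt (pi * c) by rewrite sqrtr_gt0 mulr_gt0// pi_gt0.
have : (\int[lebesgue_measure]_(x in [set: R]) (((Num.sqrt (pi * c))^-1)%:E *
    (expR (- (x ^+ 2 / c)))%:E) = 1)%E.
  rewrite -(integral_normal_pdf 0 s); apply: eq_integral => x _.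
  rewrite normal_pdfE// -EFinM; congr (_ * _)%:E.
    by rewrite /normal_peak -{1}s2 mulrnAr mulrC.
  by rewrite /normal_fun subr0 s2 mulNr.
rewrite ge0_integralZl//.
- move=> H; rewrite -[LHS]mul1e -(divff (lt0r_neq0 sp)) EFinM -muleA.
  by rewrite H mule1.
- apply/measurable_EFinP; apply: measurableT_comp => //.
  by apply: measurableT_comp => //; exact: measurable_funM.
Qed.

Lemma measurable_Rd_sqnorm d : measurable_fun setT (@Rd_sqnorm R d).
Proof.
apply: measurable_sum => i; apply: measurable_funX; exact: measurable_tnth.
Qed.

Lemma Rd_sqnorm_cons d (x : R) (y : Rd R d) :
  Rd_sqnorm (Rd_cons (x, y)) = x ^+ 2 + Rd_sqnorm y.
Proof.
rewrite /Rd_sqnorm big_ord_recl; congr (_ + _).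
by apply: eq_bigr => i _; rewrite (tnth_nth 0) (tnth_nth 0).
Qed.

Lemma Rd_sqnorm_ge0 d (y : Rd R d) : 0 <= Rd_sqnorm y.
Proof. by apply: sumr_ge0 => i _; exact: sqr_ge0. Qed.

Lemma integral_lebesgue_Rd d (f : Rd R d.+1 -> \bar R) :
  measurable_fun setT f -> (forall y, 0 <= f y)%E ->
  (\int[lebesgue_Rd d.+1]_y f y =
   \int[lebesgue_measure]_x \int[lebesgue_Rd d]_y f (Rd_cons (x, y)))%E.
Proof.
move=> mf f0.
pose pm : {measure set (measurableTypeR R * Rd R d) -> \bar R} :=
  (@lebesgue_measure R \x lebesgue_Rd d)%E.
transitivity (\int[pm]_z (f \o @Rd_cons R d) z)%E.
  rewrite -[RHS](@ge0_integral_pushforward _ _ _ _ R _ (@measurable_Rd_cons R d) pm setT f)//.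
rewrite fubini_tonelli1//=.
exact: (measurableT_comp mf (@measurable_Rd_cons R d)).
Qed.

Lemma integral_gauss_Rd d (c : R) : 0 < c ->
  (\int[lebesgue_Rd d]_y (expR (- (Rd_sqnorm y / c)))%:E =
   (Num.sqrt (pi * c) ^+ d)%:E)%E.
Proof.
move=> c0; have mexp n : measurable_fun setT
    (fun y : Rd R n => (expR (- (Rd_sqnorm y / c)))%:E).
  apply/measurable_EFinP; apply: measurableT_comp => //.
  apply: measurableT_comp => //; apply: measurable_funM => //.
  exact: measurable_Rd_sqnorm.
have exp0 n (y : Rd R n) : (0 <= (expR (- (Rd_sqnorm y / c)))%:E)%E.
  by rewrite lee_fin expR_ge0.
elim: d => [|d IH].
  rewrite [LHS]integral_dirac//=; last exact: mexp.
  rewrite diracE mem_set// mul1e /Rd_sqnorm big_ord0 mul0r oppr0 expR0.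
  by rewrite expr0.
rewrite integral_lebesgue_Rd//.
under eq_integral => x _.
  under eq_integral => y _ do rewrite Rd_sqnorm_cons mulrDl opprD expRD EFinM.
  rewrite ge0_integralZl//; last exact: mexp.
  rewrite IH muleC; over.
rewrite ge0_integralZl//; first by rewrite integral_gauss// -EFinM exprSr.
- apply/measurable_EFinP; apply: measurableT_comp => //.
  by apply: measurableT_comp => //; exact: measurable_funM.
Qed.

Lemma heat_kernel_ge0 d (t : R) (x : Rd R d) : 0 <= heat_kernel t x.
Proof.
by rewrite /heat_kernel; case: ifP => // _; rewrite mulr_ge0 ?powR_ge0 ?expR_ge0.
Qed.

Lemma measurable_heat_kernel d :
  measurable_fun setT (fun z : measurableTypeR R * Rd R d => heat_kernel z.1 z.2).
Proof.
(* The quotient becomes a power with exponent -1, to which measurability of powers applies; the two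
   agree on the branch of positive time. *)
rewrite (_ : (fun _ => _) = (fun z => if 0 < z.1 then
    (4 * pi * z.1) `^ (- (d%:R / 2)) *
    expR (- (Rd_sqnorm z.2 * (4 * z.1) `^ (-1))) else 0)); last first.
  apply/funext => z; rewrite /heat_kernel; case: ifPn => // z0.
  by rewrite powR_inv1// mulr_ge0// ltW.
apply: measurable_fun_ifT => //; first exact: measurable_fun_ltr.
apply: measurable_funM.
  apply: (measurableT_comp (measurable_powR _)); exact: measurable_funM.
apply: measurableT_comp => //; apply: measurableT_comp => //.
apply: measurable_funM.
  exact: (measurableT_comp (@measurable_Rd_sqnorm d) measurable_snd).
apply: (measurableT_comp (measurable_powR _)); exact: measurable_funM.
Qed.

Lemma measurable_heat_kernel_x d (t : R) :
  measurable_fun setT (heat_kernel t : Rd R d -> R).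
Proof.
exact: (measurableT_comp (@measurable_heat_kernel d) (measurable_pair1 t)).
Qed.

Lemma integral_heat_kernel d (t : R) : 0 < t ->
  (\int[lebesgue_Rd d]_y (heat_kernel t y)%:E = 1)%E.
Proof.
move=> t0; have t4 : 0 < 4 * t by rewrite mulr_gt0.
have pt : 0 < pi * (4 * t) by rewrite mulr_gt0// pi_gt0.
have E : 4 * pi * t = pi * (4 * t) by ring.
under eq_integral => y _ do rewrite /heat_kernel t0 EFinM E.
rewrite ge0_integralZl//.
- rewrite integral_gauss_Rd// -EFinM; congr EFin.
  rewrite -powR12_sqrt 1?ltW// -powR_mulrn ?powR_ge0// -powRrM -powRD; last first.
    by rewrite (gt_eqF pt) implybT.
  by rewrite [_ + _](_ : _ = 0) ?powRr0//; field.
- apply/measurable_EFinP; apply: measurableT_comp => //.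
  apply: measurableT_comp => //; apply: measurable_funM => //.
  exact: measurable_Rd_sqnorm.
- by rewrite lee_fin powR_ge0.
Qed.

(** Write g^r = g^(r-1) g and bound the first factor by g <= t^(-d/2), which holds because 4 pi >= 1
    and the exponential is at most 1. *)
Lemma heat_kernel_powR_le d (t r : R) (y : Rd R d) : 0 < t -> 1 <= r ->
  heat_kernel t y `^ r <= t `^ (- (d%:R * (r - 1) / 2)) * heat_kernel t y.
Proof.
move=> t0 r1; have r0 : 0 < r by exact: lt_le_trans r1.
have r10 : 0 <= r - 1 by rewrite subr_ge0.
rewrite -mulr_powRB1 ?heat_kernel_ge0// mulrC ler_wpM2r ?heat_kernel_ge0//.
have -> : - (d%:R * (r - 1) / 2) = - (d%:R / 2) * (r - 1) by field.
rewrite powRrM; apply: ge0_ler_powR => //; rewrite ?nnegrE ?heat_kernel_ge0 ?powR_ge0//.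
rewrite /heat_kernel t0 -[leRHS]mulr1; apply: ler_pM; rewrite ?powR_ge0 ?expR_ge0//.
- rewrite !powRN lef_pV2 ?posrE ?powR_gt0// ?mulr_gt0 ?pi_gt0//.
  have tt : t <= 4 * pi * t by have := pi_ge2 R; nra.
  by apply: ge0_ler_powR; rewrite ?nnegrE ?divr_ge0 ?(le_trans (ltW t0) tt) ?(ltW t0).
- by rewrite -expR0 ler_expR oppr_le0 divr_ge0 ?Rd_sqnorm_ge0// mulr_ge0// ltW.
Qed.

Lemma integral_heat_kernel_powR d (t r : R) : 0 < t -> 1 <= r ->
  (\int[lebesgue_Rd d]_y (heat_kernel t y `^ r)%:E <=
   (t `^ (- (d%:R * (r - 1) / 2)))%:E)%E.
Proof.
move=> t0 r1; rewrite -[leRHS]mule1 -(@integral_heat_kernel d t)//.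
rewrite -ge0_integralZl//; last 3 first.
- by apply/measurable_EFinP; exact: measurable_heat_kernel_x.
- by move=> x _; rewrite lee_fin heat_kernel_ge0.
- by rewrite lee_fin powR_ge0.
apply: ge0_le_integral => //.
- by move=> x _; rewrite lee_fin powR_ge0.
- apply/measurable_EFinP; apply: (measurableT_comp (measurable_powR _)).
  exact: measurable_heat_kernel_x.
- apply/measurable_EFinP; apply: measurable_funM => //.
  exact: measurable_heat_kernel_x.
- by move=> x _; rewrite -EFinM lee_fin heat_kernel_powR_le.
Qed.

End heat_kernel_integrals.

(** * The time singularity of the kernel estimate *)

Section time_integral.
Context {R : realType}.

Lemma is_derive_powR_onem (t c s : R) : s < t ->
  is_derive s 1 (fun s => (t - s) `^ c) (- (c * (t - s) `^ (c - 1))).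
Proof.
move=> st; have ts : 0 < t - s by rewrite subr_gt0.
have d1 : is_derive s 1 (fun s : R => t - s) (-1).
  by apply: is_derive_eq; rewrite add0r mul1r.
have d2 := is_derive1_powR c ts.
have := @is_derive1_comp _ (fun x : R => x `^ c) (fun s : R => t - s) s _ _ d2 d1.
by rewrite mulrN1.
Qed.

Lemma continuous_powR_onem (t c s : R) : s < t ->
  {for s, continuous (fun s => (t - s) `^ c)}.
Proof.
move=> st; apply: differentiable_continuous; apply/derivable1_diffP.
by have [] := is_derive_powR_onem c st.
Qed.

(** Stopping at [b < t] avoids the singularity, so the fundamental theorem of calculus applies; the
    bound is independent of [b], ready for the limit. *)
Lemma integral_powR_onem_le (t a b : R) : a < 1 -> 0 < b -> b < t ->
  (\int[lebesgue_measure]_(s in `[0%R, b]) ((t - s) `^ (- a))%:E <=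
   (t `^ (1 - a) / (1 - a))%:E)%E.
Proof.
move=> a1 b0 bt; have a10 : 0 < 1 - a by rewrite subr_gt0.
have lt_t s : s \in `[0, b] -> s < t.
  by rewrite in_itv/= => /andP[_ /le_lt_trans]; exact.
pose F s := - (1 - a)^-1 * (t - s) `^ (1 - a).
have dF s : s < t -> is_derive s 1 F ((t - s) `^ (- a)).
  move=> st; have d := is_derive_powR_onem (1 - a) st.
  have := is_deriveZ (- (1 - a)^-1) d.
  rewrite scalerN /= [X in is_derive _ _ _ (- X)](_ : _ = - (t - s) `^ (- a)) ?opprK//.
  rewrite /GRing.scale/= mulrA mulNr mulVf ?gt_eqF// mulN1r.
  by congr (- (_ `^ _)); ring.
have cF s : s < t -> {for s, continuous F}.
  move=> st; apply: differentiable_continuous; apply/derivable1_diffP.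
  by have [] := dF _ st.
rewrite (@continuous_FTC2 _ (fun s => (t - s) `^ (- a)) F 0 b)//; last 3 first.
- apply: continuous_in_subspaceT => s /set_mem /= sb.
  by apply: continuous_powR_onem; exact: lt_t.
- split.
  + move=> s; rewrite in_itv/= => /andP[_ sb].
    by have [] := dF _ (lt_trans sb bt).
  + by apply: cvg_at_right_filter; apply: cF; exact: lt_trans bt.
  + by apply: cvg_at_left_filter; exact: cF.
- move=> s; rewrite in_itv/= => /andP[_ sb]; rewrite derive1E.
  by have [_ ->] := dF _ (lt_trans sb bt).
rewrite -EFinB lee_fin /F subr0.
have : 0 <= (1 - a)^-1 * (t - b) `^ (1 - a).
  by rewrite mulr_ge0 ?powR_ge0// invr_ge0 ltW.
by rewrite mulrC; lra.
Qed.

Lemma measurable_powR_onem (t c : R) (D : set R) :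
  measurable_fun D (fun s : R => ((t - s) `^ c)%:E).
Proof.
apply: measurable_funTS; apply/measurable_EFinP.
apply: (measurableT_comp (measurable_powR c)); exact: measurable_funB.
Qed.

Lemma integral_powR_singular_le (t a : R) : a < 1 -> 0 < t ->
  (\int[lebesgue_measure]_(s in `]0%R, t[) ((t - s) `^ (- a))%:E <=
   (t `^ (1 - a) / (1 - a))%:E)%E.
Proof.
move=> a1 t0.
(* The shift by 2 keeps [b 0] positive, so that each interval is nondegenerate. *)
pose b n : R := t - t / n.+2%:R.
have bt n : b n < t by rewrite /b ltrBlDr ltrDl divr_gt0.
have b0 n : 0 < b n by rewrite /b subr_gt0 ltr_pdivrMr// ltr_pMr// ltr1n.
pose Fs n : set R := `[0, b n]%classic.
have ndF : nondecreasing_seq Fs.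
  move=> m n mn; apply/subsetPset => s; rewrite /Fs /= !in_itv/= => /andP[-> /=].
  move/le_trans; apply; rewrite lerB// ler_pM2l// lef_pV2 ?posrE//.
  by rewrite ler_nat.
apply: (@le_trans _ _ (\int[lebesgue_measure]_(s in \bigcup_n Fs n) ((t - s) `^ (- a))%:E)%E).
  apply: ge0_subset_integral => //.
  - by apply: bigcup_measurable => n _; exact: measurable_itv.
  - exact: measurable_powR_onem.
  - by move=> s _; rewrite lee_fin powR_ge0.
  move=> s /=; rewrite in_itv/= => /andP[s0 st].
  have ts : 0 < t - s by rewrite subr_gt0.
  (* [s] lies below [b n] as soon as n + 2 >= t / (t - s), and truncation already gives n + 1 above
     this quotient. *)
  pose n := Num.truncn (t / (t - s)).
  exists n => //; rewrite /Fs /= in_itv/= (ltW s0)/= /b lerBrDr -lerBrDl.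
  rewrite ler_pdivrMr// mulrC -ler_pdivrMr//.
  have := truncnS_gt (t / (t - s)); rewrite -/n => /ltW /le_trans; apply.
  by rewrite ler_nat.
have cvgF : (\int[lebesgue_measure]_(s in Fs n) ((t - s) `^ (- a))%:E @[n --> \oo] -->
    \int[lebesgue_measure]_(s in \bigcup_n Fs n) ((t - s) `^ (- a))%:E)%E.
  apply: ge0_nondecreasing_set_cvg_integral => //.
  - by move=> n; exact: measurable_itv.
  - by move=> n; exact: measurable_powR_onem.
  - by move=> n s _; rewrite lee_fin powR_ge0.
rewrite -(cvg_lim _ cvgF)//; apply: lime_le; first by apply/cvg_ex; eexists; exact: cvgF.
by apply: nearW => n; exact: integral_powR_onem_le.
Qed.

End time_integral.

(** * The intensity of the Lévy noise *)

Section sigma_finite_copy.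
Context d (T : measurableType d) (R : realType).
Variables (mu : {measure set T -> \bar R}) (mu_sf : sigma_finite setT mu).

(* The proof is an argument so that the sigma-finite structure can be attached
   to the head symbol. *)
Definition sigma_finite_copy of sigma_finite setT mu : set T -> \bar R := mu.

Let copy := sigma_finite_copy mu_sf.

HB.instance Definition _ := isMeasure.Build _ _ _ copy
  (measure0 mu) (measure_ge0 mu) (@measure_semi_sigma_additive _ _ _ mu).

HB.instance Definition _ := Measure_isSigmaFinite.Build _ _ _ copy mu_sf.

End sigma_finite_copy.

(** Tonelli calls for a sigma-finite jump measure. By Markov's inequality the sets |z| >= 1/(n+1)
    have finite mass, and what they miss is the null set {0}. *)
Lemma sigma_finite_of_integral_norm (R : realType)
    (lambda : {measure set (measurableTypeR R) -> \bar R}) :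
  lambda [set (0 : R)] = 0%E -> (\int[lambda]_z `|(z : R)|%:E < +oo)%E ->
  exists lam : {sigma_finite_measure set (measurableTypeR R) -> \bar R},
    (lam : set _ -> \bar R) = lambda.
Proof.
move=> l0 lfin.
have lsf : sigma_finite setT lambda.
  pose G (n : nat) : set R := if n is n'.+1 then [set z | n'.+1%:R^-1 <= `|z|] else [set 0].
  exists G.
    apply/esym/seteqP; split => // z _.
    have [->|z0] := eqVneq z 0; first by exists 0%N.
    have z0' : 0 < `|z| by rewrite normr_gt0.
    exists (Num.truncn `|z|^-1).+1 => //=.
    rewrite -[leRHS]invrK lef_pV2 ?posrE ?invr_gt0//.
    exact/ltW/truncnS_gt.
  case=> [|n] /=; first by rewrite l0.
  have mn : measurable [set z : R | n.+1%:R^-1 <= `|z|].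
    rewrite -[X in measurable X]setTI.
    rewrite (_ : [set z : R | _] =
        (fun z : R => `|z|) @^-1` `[n.+1%:R^-1, +oo[%classic); last first.
      by apply/seteqP; split => z /=; rewrite in_itv/= andbT.
    exact: (@normr_measurable R setT measurableT).
  split => //.
  have H : ((n.+1%:R^-1)%:E * lambda [set z : R | n.+1%:R^-1 <= `|z|]%R < +oo)%E.
    apply: le_lt_trans lfin.
    have := @le_integral_abse _ _ R lambda setT measurableT (fun z : R => z%:E)
      n.+1%:R^-1.
    rewrite setTI => /= H; apply: le_trans (H _ _) => //; first by apply/measurable_EFinP.
  move: H; apply: contraTT; rewrite -leNgt leye_eq => /eqP ->.
  by rewrite gt0_muley ?lte_fin// ltxx.
by exists (sigma_finite_copy lsf).
Qed.

Lemma integral_mrestr_le d (T : measurableType d) (R : realType)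
    (mu : {measure set T -> \bar R}) (D : set T) (mD : measurable D)
    (f : T -> \bar R) : measurable_fun setT f -> (forall x, 0 <= f x)%E ->
  (\int[mrestr mu mD]_x f x <= \int[mu]_(x in D) f x)%E.
Proof.
move=> mf f0.
pose m : {measure set T -> \bar R} := mrestr mu mD.
rewrite -/m (@ge0_negligible_integral _ _ _ m setT (~` D))//; last 2 first.
- exact: measurableC.
- by rewrite /m /= /mrestr setICl measure0.
rewrite setTD setCK; apply: ge0_le_measure_integral => //.
- move=> S mS; rewrite /m /= /mrestr; apply: le_measure; rewrite ?inE//.
  exact: measurableI.

Qed.

Lemma integral_prod_separated d1 d2 (T1 : measurableType d1)
    (T2 : measurableType d2) (R : realType)
    (m1 : {sigma_finite_measure set T1 -> \bar R}) (m2 : {sigma_finite_measure set T2 -> \bar R})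
    (G : T1 -> R) (H : T2 -> R) :
  measurable_fun setT G -> measurable_fun setT H ->
  (forall x, 0 <= G x) -> (forall y, 0 <= H y) ->
  (\int[m1 \x m2]_z (G z.1 * H z.2)%:E =
   \int[m1]_x (G x)%:E * \int[m2]_y (H y)%:E)%E.
Proof.
move=> mG mH G0 H0.
have H0' : (0 <= \int[m2]_y (H y)%:E)%E by apply: integral_ge0 => y _; rewrite lee_fin.
rewrite fubini_tonelli1//=; last 2 first.
- apply/measurable_EFinP; apply: measurable_funM.
    exact: (measurableT_comp mG measurable_fst).
  exact: (measurableT_comp mH measurable_snd).
- by move=> z; rewrite lee_fin mulr_ge0.
rewrite muleC -ge0_integralZl//; last 2 first.
- exact/measurable_EFinP.
- by move=> x _; rewrite lee_fin.
apply: eq_integral => x _; rewrite muleC -ge0_integralZl//.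
- exact/measurable_EFinP.
- by move=> y _; rewrite lee_fin.
- by rewrite lee_fin.
Qed.

Lemma sigma_finite_product d1 d2 (T1 : measurableType d1)
    (T2 : measurableType d2) (R : realType)
    (m1 : {sigma_finite_measure set T1 -> \bar R})
    (m2 : {sigma_finite_measure set T2 -> \bar R}) :
  sigma_finite setT (m1 \x m2)%E.
Proof.
have /sigma_finiteP[F [TF ndF Foo]] := sigma_finiteT m1.
have /sigma_finiteP[G [TG ndG Goo]] := sigma_finiteT m2.
exists (fun n => F n `*` G n).
  apply/esym/seteqP; split => // -[x y] _.
  have [i _ Fx] : (\bigcup_i F i) x by rewrite -TF.
  have [j _ Gy] : (\bigcup_i G i) y by rewrite -TG.
  exists (maxn i j) => //; split => /=.
    by move: Fx; exact/subsetPset/ndF/leq_maxl.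
  by move: Gy; exact/subsetPset/ndG/leq_maxr.
move=> k; have [mF Fk] := Foo k; have [mG Gk] := Goo k; split.
  exact: measurableX.
by rewrite product_measure1E// lte_mul_pinfty// ge0_fin_numE.
Qed.

Section levy_intensity_integral.
Context {R : realType} (d : nat).
Variable lam : {sigma_finite_measure set (measurableTypeR R) -> \bar R}.

Let time_pos : set (jump_space R d) := [set u | 0 < (u.1.1 : R)].

Lemma measurable_time_pos : measurable time_pos.
Proof.
rewrite -[X in measurable X]setTI.
rewrite (_ : time_pos = (fun u => u.1.1) @^-1` `]0, +oo[%classic); last first.
  by apply/seteqP; split => u /=; rewrite in_itv/= andbT.
by apply: (measurableT_comp measurable_fst measurable_fst) => //; exact: measurable_itv.
Qed.

(* The product measure alone is not inferred to be sigma-finite. *)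
Let space_time : {sigma_finite_measure set (measurableTypeR R * Rd R d)%type -> \bar R} :=
  sigma_finite_copy (sigma_finite_product (@lebesgue_measure R) (lebesgue_Rd d)).

Definition levy_intensity_measure : {measure set (jump_space R d) -> \bar R} :=
  mrestr (space_time \x lam)%E measurable_time_pos.

(** Both sides unfold to the same set function, so the Poisson hypothesis holds for a genuine
    measure. *)
Lemma levy_intensity_measureE :
  (levy_intensity_measure : set _ -> \bar R) = levy_intensity lam.
Proof. by []. Qed.

(** The kernel vanishes at nonpositive times, so jumps after [t] contribute 0 without a separate
    cutoff. *)
Definition jump_response (t : R) (u : jump_space R d) : R :=
  heat_kernel (t - u.1.1) u.1.2 * `|u.2|.

Lemma jump_response_ge0 t u : 0 <= jump_response t u.
Proof. by rewrite mulr_ge0// heat_kernel_ge0. Qed.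

Lemma measurable_heat_kernel_backward (t : R) : measurable_fun setT
  (fun z : measurableTypeR R * Rd R d => heat_kernel (t - z.1) z.2).
Proof.
have mg : measurable_fun setT (fun z : measurableTypeR R * Rd R d =>
    ((t - z.1 : measurableTypeR R), z.2)).
  apply/measurable_fun_pairP; split => /=; last exact: measurable_snd.
  exact: measurable_funB.
exact: (measurableT_comp (@measurable_heat_kernel R d) mg).
Qed.

Lemma measurable_jump_response t : measurable_fun setT (jump_response t).
Proof.
apply: measurable_funM.
  exact: (measurableT_comp (measurable_heat_kernel_backward t) measurable_fst).
exact: (measurableT_comp (@normr_measurable R setT) measurable_snd).
Qed.

Lemma integral_jump_response_powR (t r : R) :
  0 < t -> 1 <= r -> d%:R * (r - 1) / 2 < 1 ->
  (\int[levy_intensity_measure]_u (jump_response t u `^ r)%:E <=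
   (t `^ (1 - d%:R * (r - 1) / 2) / (1 - d%:R * (r - 1) / 2))%:E *
   \int[lam]_z (`|z : R| `^ r)%:E)%E.
Proof.
move=> t0 r1; set a := d%:R * (r - 1) / 2 => a1.
have mpow : measurable_fun setT (fun u => (jump_response t u `^ r)%:E).
  apply/measurable_EFinP; apply: (measurableT_comp (measurable_powR r)).
  exact: measurable_jump_response.
apply: le_trans.
  by apply: integral_mrestr_le => // u; rewrite lee_fin powR_ge0.
rewrite integral_mkcond.
(* [G] absorbs the restriction to positive times, so that the integrand separates into a space-time
   factor and a jump-size factor. *)
pose G (z : measurableTypeR R * Rd R d) : R :=
  if 0 < z.1 then heat_kernel (t - z.1) z.2 `^ r else 0.
have mG : measurable_fun setT G.
  apply: measurable_fun_ifT => //; first exact: measurable_fun_ltr.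
  apply: (measurableT_comp (measurable_powR r)).
  exact: measurable_heat_kernel_backward.
have G0 z : 0 <= G z by rewrite /G; case: ifP => // _; exact: powR_ge0.
have mH : measurable_fun setT (fun z : measurableTypeR R => `|z : R| `^ r).
  by apply: (measurableT_comp (measurable_powR r)).
rewrite (eq_integral (fun u : jump_space R d => (G u.1 * `|u.2| `^ r)%:E)); last first.
  move=> u _; rewrite patchE /G; case: ifPn => uD.
    by move: uD; rewrite inE /= => ->; rewrite powRM// heat_kernel_ge0.
  by rewrite ifN ?mul0r//; apply: contra uD => u0; rewrite inE.
rewrite [leLHS](_ : _ = (\int[space_time]_z (G z)%:E *
    \int[lam]_z (`|z : R| `^ r)%:E)%E); last first.
  apply: (@integral_prod_separated _ _ _ _ R space_time lam G
    (fun z : measurableTypeR R => `|z : R| `^ r)) => //.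
apply: lee_wpmul2r; first by apply: integral_ge0 => z _; rewrite lee_fin powR_ge0.
have mGE : measurable_fun setT (fun z => (G z)%:E) by exact/measurable_EFinP.
have GE0 z : (0 <= (G z)%:E)%E by rewrite lee_fin.
rewrite /space_time /sigma_finite_copy fubini_tonelli1//=.
apply: le_trans (integral_powR_singular_le a1 t0).
rewrite [leRHS]integral_mkcond.
apply: ge0_le_integral => //.
- by move=> s _; apply: integral_ge0 => y _; rewrite lee_fin.
- exact: (measurable_fun_fubini_tonelli_F _ mGE GE0).
- apply/(measurable_restrictT _ _).1 => //; exact: measurable_powR_onem.
move=> s _; rewrite /fubini_F /G /= patchE; case: ifPn => [|sD].
  rewrite inE /= in_itv/= => /andP[-> st].
  by apply: integral_heat_kernel_powR => //; rewrite subr_gt0.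
(* Outside (0, t) either the cutoff in [G] or the kernel vanishes, and 0^r = 0 because r > 0. *)
rewrite integral0_eq// => y _; case: ifPn => // s0.
rewrite /heat_kernel ifN ?powR0 ?gt_eqF ?(lt_le_trans _ r1)//.
by apply: contra sD; rewrite subr_gt0 => st; rewrite inE /= in_itv/= s0.
Qed.

End levy_intensity_integral.

(** * Comparison of the solution with a Poisson integral *)

Section nonmeasurable_comparison.
Context d (T : measurableType d) (R : realType) (mu : {measure set T -> \bar R}).

(* The integral of a nonnegative function is a supremum over simple functions
   below it, so monotonicity needs no measurability. *)
Lemma ge0_le_integral_any (D : set T) (f g : T -> \bar R) :
  (forall x, D x -> 0 <= f x)%E -> (forall x, D x -> f x <= g x)%E ->
  (\int[mu]_(x in D) f x <= \int[mu]_(x in D) g x)%E.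
Proof.
move=> f0 fg; have g0 x : D x -> (0 <= g x)%E.
  by move=> Dx; exact: le_trans (f0 _ Dx) (fg _ Dx).
rewrite !ge0_integralE//; apply: ereal_sup_le => _ [h /= hf <-].
exists h => //= x; apply: le_trans (hf x) _.
by rewrite !patchE; case: ifPn => // /set_mem; exact: fg.
Qed.

(** Raising [g] to [+oo] on the exceptional null set makes the bound hold everywhere without
    changing the integral of [g], so nothing has to be measurable but [g]. *)
Lemma ge0_le_integral_ae_any (f g : T -> \bar R) :
  (forall x, 0 <= f x)%E -> (forall x, 0 <= g x)%E -> measurable_fun setT g ->
  {ae mu, forall x, f x <= g x}%E ->
  (\int[mu]_x f x <= \int[mu]_x g x)%E.
Proof.
move=> f0 g0 mg [N [mN N0 fgN]].
pose h x : \bar R := if x \in N then +oo%E else g x.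
have mh : measurable_fun setT h.
  apply: measurable_fun_if => //.
  - apply: (measurable_fun_bool true); rewrite setTI.
    by rewrite (_ : _ @^-1` _ = N)//; apply/seteqP; split => x; [exact: set_mem|exact: mem_set].
  - exact: measurable_funTS.
apply: (@le_trans _ _ (\int[mu]_x h x)%E).
  apply: ge0_le_integral_any => // x _; rewrite /h; case: ifPn => [_|xN].
    exact: leey.
  by apply: contrapT => fgx; move/negP: xN; apply; rewrite inE; exact: fgN.
rewrite le_eqVlt; apply/orP; left; apply/eqP; apply: ge0_ae_eq_integral => //.
- by move=> x _; rewrite /h; case: ifP => // _; exact: leey.
- exists N; split => // x /= H; apply: contrapT => xN; apply: H => _.
  by rewrite /h memNset.
Qed.

(** The integrals of the positive and negative parts both lie in [0, M], so their difference lies in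
    [-M, M]; measurability of [f] does not enter. *)
Lemma Rintegral_norm_le (D : set T) (f g : T -> R) (M : R) :
  (forall x, D x -> `|f x| <= g x) -> (\int[mu]_(x in D) (g x)%:E <= M%:E)%E ->
  `|\int[mu]_(x in D) f x| <= M.
Proof.
move=> fg gM; rewrite /Rintegral integralE.
have pos (h : T -> \bar R) : (forall x, D x -> 0 <= h x <= (g x)%:E)%E ->
    (0 <= \int[mu]_(x in D) h x <= M%:E)%E.
  move=> h0g; apply/andP; split.
    by apply: integral_ge0 => x /h0g /andP[].
  apply: le_trans gM; apply: ge0_le_integral_any => x /h0g /andP[]//.
have p1 : (0 <= \int[mu]_(x in D) (fun x => (f x)%:E)^\+ x <= M%:E)%E.
  apply: pos => x Dx; rewrite funepos_ge0 funeposE ge_max !lee_fin.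
  by rewrite (le_trans (ler_norm _) (fg x Dx))/= (le_trans _ (fg x Dx)).
have p2 : (0 <= \int[mu]_(x in D) (fun x => (f x)%:E)^\- x <= M%:E)%E.
  apply: pos => x Dx; rewrite funeneg_ge0 funenegE ge_max -EFinN !lee_fin.
  rewrite (le_trans _ (fg x Dx))/= ?(le_trans _ (fg x Dx))//.
  by rewrite -normrN ler_norm.
move: p1 p2.
case: (\int[mu]_(x in D) _)%E => [x| |]; rewrite ?leye_eq ?andbF//.
case: (\int[mu]_(x in D) _)%E => [y| |]; rewrite ?leye_eq ?andbF//.
rewrite !lee_fin /= => /andP[x0 xM] /andP[y0 yM].
by rewrite ler_norml; apply/andP; split; lra.
Qed.

End nonmeasurable_comparison.

(** An infinite right side leaves nothing to prove, whatever default value [limn] takes there; a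
    finite one gives absolute convergence. *)
Lemma norm_lim_series_le (R : realType) (u : R^nat) :
  (`|limn (series u)|%:E <= \sum_(i <oo) `|u i|%:E)%E.
Proof.
set S := (\sum_(i <oo) _)%E.
have S0 : (0 <= S)%E by apply: nneseries_ge0.
have [->|Soo] := eqVneq S +oo%E; first exact: leey.
have Sfin : S = (fine S)%:E by rewrite fineK// ge0_fin_numE// ltey.
have ub n : series (fun i => `|u i|) n <= fine S.
  rewrite -lee_fin -Sfin /series/= -sumEFin; exact: nneseries_lim_ge.
have nd : nondecreasing_seq (series (fun i => `|u i|)).
  by apply: nondecreasing_series.
have cv : cvgn (series (fun i => `|u i|)).
  by apply: nondecreasing_is_cvgn => //; exists (fine S) => _ [n _ <-].
rewrite Sfin lee_fin; apply: le_trans (lim_series_norm cv) _.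
by apply: limr_le => //; exact: nearW.
Qed.

Lemma poweRD_le (R : realType) (x y : \bar R) (r : R) :
  0 < r -> (0 <= x)%E -> (0 <= y)%E ->
  ((x + y) `^ r <= (2 `^ r)%:E * (x `^ r + y `^ r))%E.
Proof.
move=> r0; have r0' : r != 0 by rewrite gt_eqF.
have p2 : 0 < 2 `^ r :> R by rewrite powR_gt0.
case: x => [x| |]//; case: y => [y| |]//.
- rewrite !lee_fin => x0 y0.
  by have := powRD_le (ltW r0) x0 y0; rewrite -lee_fin.
- by move=> _ _; rewrite addey// !poweRyr// addey// gt0_muley// lte_fin.
- by move=> _ _; rewrite addye// !poweRyr// addye// gt0_muley// lte_fin.
- by move=> _ _; rewrite addye// !poweRyr// addye// gt0_muley// lte_fin.
Qed.

Section mild_solution_bound.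
Context {R : realType} (d : nat).

Lemma heat_kernel_le0 (t : R) (y : Rd R d) : t <= 0 -> heat_kernel t y = 0.
Proof. by move=> t0; rewrite /heat_kernel ltNge t0. Qed.

Lemma heat_kernel_sub0 (t : R) (y : Rd R d) :
  heat_kernel t (Rd_sub (Rd_zero d) y) = heat_kernel t y.
Proof.
suff sq : Rd_sqnorm (Rd_sub (Rd_zero d) y) = Rd_sqnorm y by rewrite /heat_kernel sq.
by apply: eq_bigr => i _; rewrite !tnth_mktuple sub0r sqrrN.
Qed.

(** Each positive time lag carries kernel mass 1, so the inner integral is at most [k] and the outer
    one runs over length [t]. *)
Lemma drift_norm_le (t k : R) (S : R -> Rd R d -> R) : 0 <= t ->
  (forall s y, `|S s y| <= k) ->
  `|\int[lebesgue_measure]_(s in `[0%R, t]) \int[lebesgue_Rd d]_y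
      (heat_kernel (t - s) (Rd_sub (Rd_zero d) y) * S s y)| <= k * t.
Proof.
move=> t0 Sk; have k0 : 0 <= k by exact: le_trans (Sk 0 (Rd_zero d)).
apply: (@Rintegral_norm_le _ _ _ lebesgue_measure _ _ (cst k)) => [s _|]; last first.
  rewrite [leLHS](_ : _ = k%:E * lebesgue_measure `[0%R, t])%E; last by rewrite -integral_cst.
  rewrite lebesgue_measure_itv/= lte_fin.
  case: ifP => [_|]; first by rewrite oppr0 adde0.
  by rewrite mule0 lee_fin mulr_ge0.
apply: (@Rintegral_norm_le _ _ _ (lebesgue_Rd d) _ _
    (fun y => k * heat_kernel (t - s) y)) => [y _|].
  rewrite normrM heat_kernel_sub0 ger0_norm ?heat_kernel_ge0// mulrC.
  by rewrite ler_wpM2r ?heat_kernel_ge0.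
have [st|st] := ltP s t; last first.
  under eq_integral do rewrite heat_kernel_le0 ?subr_le0// mulr0.
  by rewrite integral0.
under eq_integral do rewrite EFinM.
rewrite ge0_integralZl//; first by rewrite integral_heat_kernel ?subr_gt0// mule1.
  by apply/measurable_EFinP; exact: measurable_heat_kernel_x.
by move=> y _; rewrite lee_fin heat_kernel_ge0.
Qed.

Variables (dO : measure_display) (Omega : measurableType dO).
Variables (tau : nat -> Omega -> R) (eta : nat -> Omega -> Rd R d).
Variable (zeta : nat -> Omega -> R).

(** The set function of [point_measure], bundled as a measure so that functions can be integrated
    against it. *)
Definition random_points (w : Omega) : {measure set (jump_space R d) -> \bar R} :=
  mseries (fun i => \d_(marked_points tau eta zeta i w)) 0.

Lemma integral_random_points (f : jump_space R d -> R) w :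
  measurable_fun setT f -> (forall u, 0 <= f u) ->
  (\int[random_points w]_u (f u)%:E =
   \sum_(i <oo) (f (marked_points tau eta zeta i w))%:E)%E.
Proof.
move=> mf f0; have mEf : measurable_fun setT (fun u => (f u)%:E).
  exact/measurable_EFinP.
rewrite ge0_integral_measure_series//; last by move=> u _; rewrite lee_fin.
apply: eq_eseriesr => i _; rewrite integral_dirac//.
by rewrite diracE mem_set// mul1e.
Qed.

Lemma jump_series_norm_le (t k : R) (S : nat -> R) w : (forall i, `|S i| <= k) ->
  (`|limn (series (fun i => if (tau i w <= t)%R
     then heat_kernel (t - tau i w) (Rd_sub (Rd_zero d) (eta i w)) * S i * zeta i w
     else 0))|%:E <=
   k%:E * \int[random_points w]_u (jump_response t u)%:E)%E.
Proof.
move=> Sk; have k0 : 0 <= k by exact: le_trans (Sk 0%N).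
apply: le_trans (norm_lim_series_le _) _.
rewrite integral_random_points; last 2 first.
- exact: measurable_jump_response.
- exact: jump_response_ge0.
rewrite -nneseriesZl; last by move=> i _; rewrite lee_fin jump_response_ge0.
apply: lee_nneseries => [i _|i _]; first by rewrite lee_fin.
rewrite -EFinM lee_fin /jump_response /=; case: ifPn => [_|].
  rewrite heat_kernel_sub0 !normrM ger0_norm ?heat_kernel_ge0//.
  by rewrite mulrAC mulrC ler_wpM2r// mulr_ge0// heat_kernel_ge0.
by rewrite normr0 !mulr_ge0// heat_kernel_ge0.
Qed.

End mild_solution_bound.

(** * Moments of the jump part divided by time *)

Section jump_moment.
Context {R : realType} (d : nat).
Variable lam : {sigma_finite_measure set (measurableTypeR R) -> \bar R}.
Context {dO : measure_display} {Omega : measurableType dO}.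
Context (P : probability Omega R).
Variable N : Omega -> {measure set (jump_space R d) -> \bar R}.
Hypothesis NP : poisson_random_measure P (levy_intensity lam) (fun w => N w).

Lemma jump_response_moment (p eps : R) : (0 < d)%N -> 0 < eps ->
  (\int[lam]_z `|(z : R)|%:E < +oo)%E ->
  (\int[lam]_z (`|(z : R)| `^ (1 + eps))%:E < +oo)%E ->
  0 < p -> p <= 1 + eps -> p < 1 + 2 / d%:R ->
  exists B : R, forall t : R, 1 <= t ->
    (\int[P]_w ((\int[N w]_u (t^-1 * jump_response t u)%:E) `^ p) <= B%:E)%E.
Proof.
move=> d0 eps0 l1 leps p0 peps pd.
have d1 : (1 : R) <= d%:R by rewrite ler1n.
have dgt0 : 0 < d%:R :> R by rewrite ltr0n.
(* For p < 1 the p-th power of |z| need not be integrable near 0, and the Gaussian estimate is for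
   exponents at least 1; the second exponent is therefore raised to 1. *)
pose P' := Num.max 1 p.
have P1 : 1 <= P' by rewrite le_max lexx.
have pP : p <= P' by rewrite le_max lexx orbT.
have Peps : P' <= 1 + eps by rewrite ge_max peps lerDl ltW.
have Pd : d%:R * (P' - 1) / 2 < 1.
  rewrite ltr_pdivrMr// mul1r mulrC -ltr_pdivlMr// ltrBlDl.
  by rewrite gt_max pd ltrDl divr_gt0.
(* Since d >= 1, p < 1 + 2/d <= 3 = k + 1 with k = 2, whence the index 2 in the moment constant. *)
have p3 : p <= 3.
  apply: le_trans (ltW pd) _; rewrite -lerBrDl ler_pdivrMr//.
  by rewrite (_ : 3 - 1 = 2); [rewrite ler_peMr | ring].
set a := d%:R * (P' - 1) / 2 in Pd.
have a0 : 0 <= a by rewrite divr_ge0// mulr_ge0// subr_ge0.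
have mz : measurable_fun setT (fun z : measurableTypeR R => `|z : R|).
  exact: normr_measurable.
have mzr r : measurable_fun setT (fun z : measurableTypeR R => (`|z : R| `^ r)%:E).
  by apply/measurable_EFinP; exact: (measurableT_comp (measurable_powR r)).
have lP : (\int[lam]_z (`|(z : R)| `^ P')%:E < +oo)%E.
  apply: (@le_lt_trans _ _ (\int[lam]_z (`|(z : R)|%:E + (`|z : R| `^ (1 + eps))%:E))%E).
    apply: ge0_le_integral_any => [z _|z _]; first by rewrite lee_fin powR_ge0.
    rewrite -EFinD lee_fin.
    by have := @powR_le_interp _ _ 1 P' (1 + eps) (normr_ge0 z) ltr01 P1 Peps; rewrite powRr1.
  rewrite ge0_integralD//; first exact: lte_add_pinfty.
  - exact/measurable_EFinP.
have L0 : (0 <= \int[lam]_z `|(z : R)|%:E)%E by apply: integral_ge0.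
have LP0 : (0 <= \int[lam]_z (`|(z : R)| `^ P')%:E)%E.
  by apply: integral_ge0 => z _; rewrite lee_fin powR_ge0.
set L1 := fine (\int[lam]_z `|(z : R)|%:E)%E.
set LP := fine (\int[lam]_z (`|(z : R)| `^ P')%:E)%E.
have L1E : (\int[lam]_z `|(z : R)|%:E = L1%:E)%E by rewrite fineK// ge0_fin_numE.
have LPE : (\int[lam]_z (`|(z : R)| `^ P')%:E = LP%:E)%E by rewrite fineK// ge0_fin_numE.
have L10 : 0 <= L1 by exact: fine_ge0.
have LP0' : 0 <= LP by exact: fine_ge0.
(* [L1] and [LP / (1 - a)] bound the integrals of the response divided by t for the exponents 1 and
   [P'], uniformly in t >= 1; their sum bounds both. *)
exists (moment_const P' (L1 + LP / (1 - a)) 2) => t t1.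
have t0 : 0 < t by exact: lt_le_trans t1.
have mjr : measurable_fun setT (fun u : jump_space R d => t^-1 * jump_response t u).
  by apply: measurable_funM => //; exact: measurable_jump_response.
have jr0 (u : jump_space R d) : 0 <= t^-1 * jump_response t u.
  by rewrite mulr_ge0 ?invr_ge0 ?jump_response_ge0// ltW.
have scale r : 1 <= r ->
    (\int[levy_intensity_measure d lam]_u ((t^-1 * jump_response t u) `^ r)%:E =
     ((t^-1) `^ r)%:E * \int[levy_intensity_measure d lam]_u (jump_response t u `^ r)%:E)%E.
  move=> r1; rewrite -ge0_integralZl//.
  - by apply: eq_integral => u _; rewrite powRM ?invr_ge0 ?jump_response_ge0 ?ltW// EFinM.
  - apply/measurable_EFinP; apply: (measurableT_comp (measurable_powR r)).
    exact: measurable_jump_response.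
  - by move=> u _; rewrite lee_fin powR_ge0.
  - by rewrite lee_fin powR_ge0.
have a10 : 0 < 1 - a by rewrite subr_gt0.
apply: (@poisson_integral_moment _ _ _ P _ _ (levy_intensity_measure d lam) N NP
  _ mjr jr0 P' p _ 2) => //.
- exact: lt_le_trans P1.
- by rewrite pP orbT.
- rewrite (eq_integral (fun u => ((t^-1 * jump_response t u) `^ 1)%:E)); last first.
    by move=> u _; rewrite powRr1.
  rewrite scale//; apply: (@le_trans _ _ ((t^-1 `^ 1)%:E * (t%:E * L1%:E))%E).
    apply: lee_wpmul2l; first by rewrite lee_fin powR_ge0.
    apply: le_trans (integral_jump_response_powR _ t0 (lexx _) _) _.
      by rewrite subrr mulr0 mul0r.
    rewrite subrr mulr0 mul0r subr0 powRr1 ?(ltW t0)// divr1.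
    under eq_integral do rewrite powRr1//.
    by rewrite L1E.
  rewrite powRr1 ?invr_ge0 ?(ltW t0)// -!EFinM mulrA mulVf ?gt_eqF// mul1r lee_fin.
  by rewrite lerDl divr_ge0// ltW.
- rewrite scale//; apply: le_trans.
    apply: lee_wpmul2l; first by rewrite lee_fin powR_ge0.
    exact: integral_jump_response_powR t0 P1 Pd.
  rewrite LPE -/a -!EFinM lee_fin.
  apply: (@le_trans _ _ (LP / (1 - a))); last by rewrite lerDr.
  rewrite mulrA [leRHS]mulrC; apply: ler_wpM2r => //.
  rewrite mulrA ler_piMl ?invr_ge0 ?(ltW a10)//.
  (* Power counting: t^(-P') t^(1-a) <= 1, because t >= 1 and 1 - a <= 1 <= P'. *)
  rewrite -powR_inv1 ?(ltW t0)// -powRrM mulN1r powRN mulrC ler_pdivrMr ?powR_gt0// mul1r.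
  by apply: ler_powR => //; apply: le_trans P1; rewrite lerBlDr lerDl.
Qed.

End jump_moment.

Theorem theorem2p11 (R : realType) (dO : measure_display)
  (Omega : measurableType dO) (P : probability Omega R)
  (F : R -> set (set Omega)) (d : nat)
  (lambda : {measure set (measurableTypeR R) -> \bar R}) (m : R)
  (tau : nat -> Omega -> R) (eta : nat -> Omega -> Rd R d)
  (zeta : nat -> Omega -> R) (sigma : R -> R) (k1 k2 : R)
  (Y : R -> Rd R d -> Omega -> R) (eps : R) :
  (0 < d)%N ->
  filtration F ->
  levy_measure lambda ->
  lambda setT != 0%E ->
  (\int[lambda]_z `|(z : R)|%:E < +oo)%E ->
  levy_poisson_points P F lambda tau eta zeta ->
  [lipschitz sigma x | x in [set: R]] ->
  0 < k1 -> 0 < k2 -> (forall x, k1 < sigma x < k2) ->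
  mild_solution P F (m - \int[lambda]_z (z : R)) tau eta zeta sigma Y ->
  0 < eps ->
  (\int[lambda]_z (`|(z : R)| `^ (1 + eps))%:E < +oo)%E ->
  (\int[lambda]_(z in `[(-1)%R, 1%R]) `|(z : R) * ln `|(z : R)| |%:E < +oo)%E ->
  forall p : R, 0 < p -> p <= 1 + eps -> p < 1 + 2 / d%:R ->
  (limf_esup (fun t : R => 'E_P[fun w => (`|Y t (Rd_zero d) w / t| `^ p)%R])
     +oo%R < +oo)%E.
Proof.
move=> d0 _ [l0 _] _ l1 pts _ k10 k20 sk mild eps0 leps _ p p0 peps pd.
have [lam lamE] := sigma_finite_of_integral_norm l0 l1.
(* The product depends on its second factor only as a set function, so the equality passes through
   it. *)
have lamI : @levy_intensity R d lam = @levy_intensity R d lambda.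
  exact: (congr1 (fun (l : set (measurableTypeR R) -> \bar R) A =>
    ((@lebesgue_measure R \x lebesgue_Rd d) \x l)%E
      (A `&` [set u : jump_space R d | 0 < (u.1.1 : R)])) lamE).
pose N := random_points tau eta zeta.
have NP : poisson_random_measure P (levy_intensity lam) (fun w => N w).
  by rewrite lamI; exact: (lpp_poisson pts).
have sk2 x : `|sigma x| <= k2.
  by have /andP[s1 /ltW s2] := sk x; rewrite gtr0_norm// (lt_trans k10).
rewrite -lamE in l1 leps.
have [B HB] := jump_response_moment NP d0 eps0 l1 leps p0 peps pd.
set m0 : R := m - \int[lambda]_z (z : R) in mild.
(* After division by t the drift contributes at most |m0| k2, whatever t is. *)
pose c : R := (`|m0| * k2) `^ p.
have bound (t : R) : 1 <= t ->
    ('E_P[fun w => (`|Y t (Rd_zero d) w / t| `^ p)%R] <=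
     (2 `^ p)%:E * (c%:E + (k2 `^ p)%:E * B%:E))%E.
  move=> t1; have t0 : 0 < t by exact: lt_le_trans t1.
  pose T w := (\int[N w]_u (t^-1 * jump_response t u)%:E)%E.
  have mjr : measurable_fun setT (fun u : jump_space R d => t^-1 * jump_response t u).
    by apply: measurable_funM => //; exact: measurable_jump_response.
  have jr0 (u : jump_space R d) : 0 <= t^-1 * jump_response t u.
    by rewrite mulr_ge0 ?invr_ge0 ?jump_response_ge0// ltW.
  have T0 w : (0 <= T w)%E by apply: integral_ge0 => u _; rewrite lee_fin.
  have mTp : measurable_fun setT (fun w => T w `^ p)%E.
    apply: (measurableT_comp (measurable_poweR p)).
    rewrite -(levy_intensity_measureE d lam) in NP.
    exact: (measurable_poisson_integral NP mjr jr0).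
  have mkTp : measurable_fun setT (fun w => (k2 `^ p)%:E * T w `^ p)%E.
    exact: emeasurable_funM.
  have kTp0 w : (0 <= (k2 `^ p)%:E * T w `^ p)%E.
    by rewrite mule_ge0 ?lee_fin ?powR_ge0 ?poweR_ge0.
  have c0 : 0 <= c by exact: powR_ge0.
  pose G w := ((2 `^ p)%:E * (c%:E + (k2 `^ p)%:E * T w `^ p))%E.
  have sum0 w : (0 <= c%:E + (k2 `^ p)%:E * T w `^ p)%E.
    by rewrite adde_ge0 ?lee_fin.
  have msum : measurable_fun setT (fun w => c%:E + (k2 `^ p)%:E * T w `^ p)%E.
    exact: emeasurable_funD.
  rewrite unlock; apply: (@le_trans _ _ (\int[P]_w G w)%E).
    apply: ge0_le_integral_ae_any.
    - by move=> w; rewrite lee_fin powR_ge0.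
    - by move=> w; rewrite mule_ge0 ?lee_fin ?powR_ge0.
    - exact: emeasurable_funM.
    apply: filterS (mild_equation mild (Rd_zero d) (ltW t0)) => w Yw.
    (* [T w] may be infinite, and then the bound is vacuous. *)
    have Ybound : (`|Y t (Rd_zero d) w / t|%:E <= (`|m0| * k2)%:E + k2%:E * T w)%E.
      rewrite Yw; set D := \int[_]_(s in _) _; set L := limn _.
      have D1 : `|D| <= k2 * t by apply: drift_norm_le => //; exact: ltW.
      have L1 : (`|L|%:E <= k2%:E * \int[N w]_u (jump_response t u)%:E)%E.
        exact: (@jump_series_norm_le R d dO Omega tau eta zeta t k2
          (fun i => sigma (Y (tau i w) (eta i w) w)) w).
      have -> : T w = ((t^-1)%:E * \int[N w]_u (jump_response t u)%:E)%E.
        rewrite /T -ge0_integralZl//.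
        - by apply/measurable_EFinP; exact: measurable_jump_response.
        - by move=> u _; rewrite lee_fin jump_response_ge0.
        - by rewrite lee_fin invr_ge0 ltW.
      apply: (@le_trans _ _ ((`|m0| * k2)%:E + (t^-1)%:E * `|L|%:E)%E).
        rewrite -EFinM -EFinD lee_fin normrM normfV (gtr0_norm t0).
        rewrite ler_pdivrMr// [leRHS](_ : _ = `|m0| * k2 * t + `|L|); last first.
          by field; rewrite gt_eqF.
        apply: le_trans (ler_normD _ _) _; rewrite lerD2r normrM -mulrA.
        exact: ler_wpM2l.
      apply: leeD2l; rewrite muleCA; apply: lee_wpmul2l => //.
      by rewrite lee_fin invr_ge0 ltW.
    rewrite -poweR_EFin.
    apply: (@le_trans _ _ (((`|m0| * k2)%:E + k2%:E * T w) `^ p)%E).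
      apply: gt0_ler_poweR; rewrite ?in_itv/= ?leey ?andbT ?(ltW p0)//.
      by rewrite adde_ge0// ?mule_ge0// lee_fin ?mulr_ge0// ltW.
    apply: le_trans (poweRD_le p0 _ _) _.
    - by rewrite lee_fin mulr_ge0// ltW.
    - by rewrite mule_ge0// lee_fin ltW.
    by rewrite poweRM ?lee_fin ?(ltW k20).
  rewrite /G ge0_integralZl ?lee_fin ?powR_ge0//.
  apply: lee_wpmul2l; first by rewrite lee_fin powR_ge0.
  rewrite ge0_integralD//.
  apply: leeD.
    rewrite integral_cst// -[leRHS]mule1; apply: lee_wpmul2l; first by rewrite lee_fin.
    exact: probability_le1.
  rewrite ge0_integralZl ?lee_fin ?powR_ge0//; last by move=> w _; exact: poweR_ge0.
  by apply: lee_wpmul2l; [rewrite lee_fin powR_ge0|exact: HB].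
apply: (@le_lt_trans _ _ ((2 `^ p)%:E * (c%:E + (k2 `^ p)%:E * B%:E))%E); last first.
  exact: (ltry (2 `^ p * (c + k2 `^ p * B))).
(* The upper limit is an infimum of suprema over neighbourhoods of infinity; the half-line t >= 1 is
   one of them. *)
apply: (@le_trans _ _ (ereal_sup ((fun t : R =>
    'E_P[fun w => (`|Y t (Rd_zero d) w / t| `^ p)%R])%E @` [set t | 1 <= t]))).
  apply: ereal_inf_lbound; exists [set t | 1 <= t] => //.
  exact: nbhs_pinfty_ge.
by apply: ge_ereal_sup => _ [t /= t1 <-]; exact: bound.
Qed.
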